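(* Let $a\in\mathbb C$, $a\ne0$, and let $(z_k)_{k\in\mathbb N}$ be the sequence defined in the context (with $\lambda=-a^4/2$). Put $x_k=a/z_k$ for $k\in\mathbb N$. Then there is a root $z^*$ of $z^5+z^4=-a^4$ such that $x^*=a/z^*$, which is a root of $x^5+x+a=0$, satisfies: 1. $|x_1-x^*|<C_2$ with $C_2=2.90\times10^{-2}$; 2. $\left|\dfrac{x_1}{x^*}-1\right|<C_1'$ with $C_1'=2.57\times10^{-2}$; 3. for all integers $k\ge1$, $$|x_{k+1}-x^*|<\frac1{K'}|x_k-x^*|\qquad\text{and}\qquad |x_{k+1}-x^*|<\frac{C_2}{K'^{\,k}},\qquad K'=14.68 .$$
   Context: Convention: the $n$-th root of a complex number (also written as the power $1/n$) is the one whose argument lies in $[-\pi/n,\pi/n[$. Given $a\neq0$, put $\lambda=-\frac{a^4}{2}$ and $\alpha=\sqrt{\frac{2+\sqrt2}{4}}$. The sequence $(z_k)$ is defined by $$z_0=\left(\frac{|\lambda|}{\alpha}\right)^{2/9}\left(\frac{\lambda}{|\lambda|}\right)^{1/5},$$ $$z_{k+1}=\sqrt[5]{2\lambda+\frac25 m_k^3+\frac2{25}m_k^2+\frac1{125}m_k+\frac1{3125}}-\frac15,\qquad m_k=\sqrt[4]{\frac{2\lambda}{1+z_k}}\qquad(k\ge 0).$$ The substitution $z=a/x$ turns $x^5+x+a=0$ into $z^5+z^4=-a^4$. *)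

(* Defs.v *)
From Stdlib Require Import Reals Lra Lia.
From Coquelicot Require Import Coquelicot.

Open Scope R_scope.

(* e^(i t) *)
Definition Cis (t : R) : C := (cos t, sin t).

(* Argument in [-PI, PI[ : negative real numbers have argument -PI.
   Meaningful for z <> 0 only; see [Carg_spec]. *)
Definition Carg (z : C) : R :=
  if Rlt_dec 0 (Im z) then acos (Re z / Cmod z) else - acos (Re z / Cmod z).

(* The n-th root whose argument lies in [-PI/n, PI/n[; see [Croot_spec].
   Zero is treated apart because [Rpower 0 y] is not 0. *)
Definition Croot (n : nat) (w : C) : C :=
  if Ceq_dec w 0 then RtoC 0
  else (RtoC (Rpower (Cmod w) (/ INR n)) * Cis (Carg w / INR n))%C.

Definition lam (a : C) : C := (- (a ^ 4) / 2)%C.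

Definition alpha : R := sqrt ((2 + sqrt 2) / 4).

Definition m_of (a z : C) : C := Croot 4 (2 * lam a / (1 + z))%C.

Fixpoint zseq (a : C) (k : nat) : C :=
  match k with
  | O => (RtoC (Rpower (Cmod (lam a) / alpha) (2 / 9))
          * Croot 5 (lam a / RtoC (Cmod (lam a))))%C
  | S k' =>
      let m := m_of a (zseq a k') in
      (Croot 5 (2 * lam a + 2 / 5 * m ^ 3 + 2 / 25 * m ^ 2
                + 1 / 125 * m + 1 / 3125) - 1 / 5)%C
  end.

Definition xseq (a : C) (k : nat) : C := (a / zseq a k)%C.

Lemma Cis_plus (s t : R) : Cis (s + t) = (Cis s * Cis t)%C.
Proof.
  unfold Cis, Cmult; simpl. rewrite cos_plus, sin_plus. f_equal; ring.
Qed.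

Lemma Cis_pow (n : nat) (t : R) : (Cis t ^ n)%C = Cis (INR n * t).
Proof.
  induction n as [|n IH].
  - simpl. unfold Cis. rewrite Rmult_0_l, cos_0, sin_0. reflexivity.
  - rewrite Cpow_S, IH, <- Cis_plus, S_INR. f_equal; ring.
Qed.

Lemma Cmod_Cis (t : R) : Cmod (Cis t) = 1.
Proof.
  unfold Cmod, Cis; simpl fst; simpl snd.
  replace (cos t ^ 2 + sin t ^ 2) with 1; [apply sqrt_1|].
  generalize (sin2_cos2 t); unfold Rsqr; lra.
Qed.

Lemma Cmod_polar (r t : R) : 0 <= r -> Cmod (RtoC r * Cis t) = r.
Proof.
  intros Hr. rewrite Cmod_mult, Cmod_Cis, Cmod_R, Rabs_pos_eq by exact Hr. ring.
Qed.

Lemma Carg_polar (z : C) : z <> 0 ->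
  - PI <= Carg z < PI /\ z = (RtoC (Cmod z) * Cis (Carg z))%C.
Proof.
  intros Hz.
  assert (Hr : 0 < Cmod z) by (apply Cmod_gt_0; exact Hz).
  pose proof (Cmod2_alt z) as Hm.
  destruct z as [x y]; unfold Carg; simpl Re in *; simpl Im in *.
  set (r := Cmod (x, y)) in *.
  assert (Hc : -1 <= x / r <= 1).
  { assert (- r <= x <= r) by nra.
    split; [apply Rle_div_r|apply Rle_div_l]; lra. }
  pose proof (cos_acos _ Hc) as Hcos.
  pose proof (sin_acos _ Hc) as Hsin.
  pose proof (acos_bound (x / r)) as Hb.
  assert (Hs : sqrt (1 - Rsqr (x / r)) = Rabs y / r).
  { replace (1 - Rsqr (x / r)) with (Rsqr (y / r)).
    - rewrite sqrt_Rsqr_abs. unfold Rdiv.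
      rewrite Rabs_mult, (Rabs_pos_eq (/ r)); [reflexivity|].
      left; apply Rinv_0_lt_compat; exact Hr.
    - replace (Rsqr (y / r)) with (y * y / (r * r))
        by (unfold Rsqr; field; lra).
      replace (y * y) with (r * r - x * x) by lra.
      unfold Rsqr; field; lra. }
  rewrite Hs in Hsin.
  destruct (Rlt_dec 0 y) as [Hy|Hy].
  - split.
    + split; [lra|]. destruct (Req_dec (acos (x / r)) PI) as [E|E]; [|lra].
      exfalso. rewrite E, sin_PI in Hsin. rewrite Rabs_pos_eq in Hsin by lra.
      assert (0 < y / r) by (apply Rdiv_lt_0_compat; lra). lra.
    + unfold Cis, Cmult, RtoC; simpl. rewrite Hcos, Hsin, Rabs_pos_eq by lra.
      f_equal; field; lra.
  - split.
    + pose proof PI_RGT_0; lra.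
    + unfold Cis, Cmult, RtoC; simpl.
      rewrite cos_neg, sin_neg, Hcos, Hsin, Rabs_left1 by lra.
      f_equal; field; lra.
Qed.

Lemma Cis_inj (s t : R) :
  - PI <= s < PI -> - PI <= t < PI -> Cis s = Cis t -> s = t.
Proof.
  intros Hs Ht H. injection H as Hc Hn.
  assert (E : cos (s - t) = 1).
  { rewrite cos_minus, Hc, Hn. generalize (sin2_cos2 t); unfold Rsqr; lra. }
  set (h := (s - t) / 2).
  assert (S0 : sin h = 0).
  { replace (s - t) with (2 * h) in E by (unfold h; field).
    rewrite cos_2a_sin in E. nra. }
  assert (Hh : - PI < h < PI) by (unfold h; lra).
  destruct (Rtotal_order h 0) as [L|[Z|G]].
  - exfalso. assert (0 < sin (- h)) by (apply sin_gt_0; lra).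
    rewrite sin_neg in H; lra.
  - unfold h in Z; lra.
  - exfalso. assert (0 < sin h) by (apply sin_gt_0; lra). lra.
Qed.

Lemma Carg_eq (r t : R) :
  0 < r -> - PI <= t < PI -> Carg (RtoC r * Cis t) = t.
Proof.
  intros Hr Ht. set (z := (RtoC r * Cis t)%C).
  assert (Hm : Cmod z = r) by (apply Cmod_polar; lra).
  assert (Hz : z <> 0) by (apply Cmod_gt_0; lra).
  destruct (Carg_polar z Hz) as [Hb E].
  apply Cis_inj; [exact Hb|exact Ht|].
  rewrite Hm in E. unfold z at 1 in E.
  assert (Hr' : RtoC r <> 0) by (intros F; apply RtoC_inj in F; lra).
  apply (f_equal (fun u => (/ RtoC r * u)%C)) in E.
  rewrite !Cmult_assoc, Cinv_l, !Cmult_1_l in E by exact Hr'.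
  symmetry; exact E.
Qed.

Lemma Carg_spec (z : C) (t : R) : z <> 0 ->
  (t = Carg z <-> - PI <= t < PI /\ z = (RtoC (Cmod z) * Cis t)%C).
Proof.
  intros Hz. split.
  - intros ->. apply Carg_polar; exact Hz.
  - intros [Ht E]. rewrite E. symmetry. apply Carg_eq; [|exact Ht].
    apply Cmod_gt_0; exact Hz.
Qed.

Lemma Croot_spec (n : nat) (w r : C) : (1 <= n)%nat -> w <> 0 ->
  (r = Croot n w <->
   (r ^ n)%C = w /\ - PI / INR n <= Carg r < PI / INR n).
Proof.
  intros Hn Hw.
  assert (Hn' : 1 <= INR n) by (change 1 with (INR 1); apply le_INR; exact Hn).
  assert (HI : 0 < / INR n <= 1).
  { split; [apply Rinv_0_lt_compat; lra|]. rewrite <- Rinv_1.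
    apply Rinv_le_contravar; lra. }
  pose proof PI_RGT_0 as Hpi.
  assert (Hmw : 0 < Cmod w) by (apply Cmod_gt_0; exact Hw).
  destruct (Carg_polar w Hw) as [Hb E].
  assert (Hdef : Croot n w =
    (RtoC (Rpower (Cmod w) (/ INR n)) * Cis (Carg w / INR n))%C).
  { unfold Croot. destruct (Ceq_dec w 0); [contradiction|reflexivity]. }
  rewrite Hdef. split.
  - intros ->.
    assert (Hp : 0 < Rpower (Cmod w) (/ INR n)) by apply exp_pos.
    assert (Hbn : - PI / INR n <= Carg w / INR n < PI / INR n).
    { unfold Rdiv. split; [apply Rmult_le_compat_r|apply Rmult_lt_compat_r]; lra. }
    split.
    + rewrite Cpow_mult_l, Cis_pow, <- RtoC_pow, <- Rpower_pow, Rpower_mult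
        by exact Hp.
      rewrite Rinv_l, Rpower_1 by lra.
      replace (INR n * (Carg w / INR n)) with (Carg w) by (field; lra).
      symmetry; exact E.
    + rewrite Carg_eq; [exact Hbn|exact Hp|].
      unfold Rdiv in Hbn |- *. nra.
  - intros [Hpow Hr].
    assert (Hr0 : r <> 0).
    { intros F. apply Hw. rewrite <- Hpow, F. destruct n; [lia|].
      rewrite Cpow_S. apply Cmult_0_l. }
    assert (Hmr : 0 < Cmod r) by (apply Cmod_gt_0; exact Hr0).
    destruct (Carg_polar r Hr0) as [_ Er].
    assert (Em : Cmod w = Cmod r ^ n) by (rewrite <- Hpow; apply Cmod_pow).
    assert (Ea : Carg w = INR n * Carg r).
    { rewrite <- Hpow, Er at 1.
      rewrite Cpow_mult_l, Cis_pow, <- RtoC_pow.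
      apply Carg_eq; [apply pow_lt; exact Hmr|].
      destruct Hr as [H1 H2].
      apply (Rmult_le_compat_l (INR n)) in H1; [|lra].
      apply (Rmult_lt_compat_l (INR n)) in H2; [|lra].
      replace (INR n * (- PI / INR n)) with (- PI) in H1 by (field; lra).
      replace (INR n * (PI / INR n)) with PI in H2 by (field; lra).
      lra. }
    rewrite Em, Ea, <- Rpower_pow, Rpower_mult, Rinv_r, Rpower_1 by lra.
    replace (INR n * Carg r / INR n) with (Carg r) by (field; lra).
    exact Er.
Qed.

(* Main.v *)
Require Import Defs.
From Stdlib Require Import Reals Lra Lia Psatz.
From Coquelicot Require Import Coquelicot.
Open Scope R_scope.

(* Put [W = 2 lam a = -a^4], of argument [th]. All the numbers that occur have an argument
   [c th] with [c] in a known subinterval of [0, 1], so no branch cut is ever crossed. The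
   equation [s^4 (1 + s) = W] has a root [s] with [c] in [1/5, 1/4]; then [m = s] is the
   fourth root of [W / (1 + s)] and [radicand W s = (s + 1/5)^5], so [s] is a fixed point.
   For a step [z -> m -> t],
     [(m - s) (m^3 + m^2 s + m s^2 + s^3) (1 + z) = s^4 (s - z)] and
     [(t + 1/5)^5 - (s + 1/5)^5 = (m - s) (2/5 (m^2 + m s + s^2) + 2/25 (m + s) + 1/125)],
   and sums of terms lying in a narrow sector are almost as large as the sums of their moduli.
   For [|s - z| <= 0.0257 |z|] this gives a contraction of factor at most 0.06. For the first
   step, [|z_0| >= |s|] and [|W - z_0^4 (1 + z_0)| <= |z_0^4 (1 + z_0)|] bound [s - z_0],
   and the result is a polynomial inequality in [|s|]. *)

(** The errors to bound are relative errors in disguise: [|a/z - a/s| = |a/s| |s - z| / |z|], where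
    [|a/s|^4 = |1 + s|]. This factor is unbounded in [a], so a uniform relative bound cannot give
    the absolute constant 0.0290. The first step therefore has to produce a [p], with relative error
    at most [p / (4.7 - p)], that satisfies both [p <= 0.117] and [(1 + |s|) p^4 <= 0.00031]; the
    second condition forces [p] to shrink as [|s|] grows, which is why the range of [|s|] is split.
    In the later steps the factor [|a/s|] cancels, and 0.06 stays below [1 / 14.68]. Strictness
    there also needs that no iterate equals [s]; this is proved separately, by carrying [s <> z]
    from each iterate to the next. *)

(** * Numerical bounds for [PI] and the cosine *)

(** At [x = PI / 6] the Taylor bound reads [x - x^3 / 6 <= 1/2]. The cubic increases up to 2/3,
    which is as far as [PI <= 4] lets [x] go, and it already exceeds 1/2 at 0.525. *)
Lemma PI_lt_315 : PI < 3.15.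
Proof.
  pose proof PI_4 as H4. pose proof PI_RGT_0 as H0.
  destruct (pre_sin_bound (PI / 6) 0) as [H _]; [lra | lra |].
  rewrite sin_PI6 in H. unfold sin_approx, sin_term in H.
  set (x := PI / 6) in *.
  replace (sum_f_R0 _ _) with (x - x ^ 3 / 6) in H by (cbn; field).
  assert (Hx : 0 < x <= 2 / 3) by (unfold x; lra).
  destruct (Rlt_le_dec x 0.525) as [L|L]; [unfold x in *; lra|exfalso].
  (* The product is six times the difference of the cubic at [x] and at 0.525. *)
  assert (0 <= (x - 0.525) * (6 - (x ^ 2 + 0.525 * x + 0.525 ^ 2))).
  { apply Rmult_le_pos; [lra|]. assert (x ^ 2 <= 1) by nra. lra. }
  lra.
Qed.

Lemma cos_lower (x : R) : 1 - x ^ 2 / 2 <= cos x.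
Proof.
  replace x with (2 * (x / 2)) at 2 by field. rewrite cos_2a_sin.
  assert (H : (sin (x / 2)) ^ 2 <= (x / 2) ^ 2); [|nra].
  assert (G : forall u, 0 <= u -> - u <= sin u <= u).
  { intros u [Hu| <-]; [|rewrite sin_0; lra].
    pose proof (sin_lt_x u Hu). destruct (Rle_lt_dec u PI) as [L|L].
    - pose proof (sin_ge_0 u (Rlt_le _ _ Hu) L). lra.
    - pose proof (SIN_bound u). pose proof PI2_1. lra. }
  destruct (Rle_lt_dec 0 (x / 2)) as [L|L].
  - specialize (G _ L). nra.
  - specialize (G (- (x / 2))). rewrite sin_neg in G. nra.
Qed.

Lemma cos_le_cos_abs (x y : R) : Rabs x <= Rabs y -> Rabs y <= PI -> cos y <= cos x.
Proof.
  intros H1 H2.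
  assert (E : forall u, cos (Rabs u) = cos u).
  { intros u. unfold Rabs. destruct (Rcase_abs u); [apply cos_neg|reflexivity]. }
  rewrite <- (E x), <- (E y). pose proof (Rabs_pos x).
  destruct H1 as [H1| ->]; [|lra].
  left. apply cos_decreasing_1; lra.
Qed.

Lemma Cdiv_RtoC (p q : R) : 0 < q -> (RtoC p / RtoC q)%C = RtoC (p / q).
Proof. intros Hq. rewrite RtoC_div by lra. reflexivity. Qed.

(** * Sectors *)

(* A signed opening [th] lets one statement cover both half-planes;
   [th] is the argument of [-a^4] below. *)
Definition sector (th l h : R) (z : C) : Prop :=
  exists r c, 0 < r /\ l <= c <= h /\ z = (RtoC r * Cis (c * th))%C.

Lemma Cis_0 : Cis 0 = 1.
Proof. unfold Cis. rewrite cos_0, sin_0. reflexivity. Qed.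

Lemma sector_Cmod th l h z : sector th l h z ->
  0 < Cmod z /\ exists c, l <= c <= h /\ z = (RtoC (Cmod z) * Cis (c * th))%C.
Proof.
  intros (r & c & Hr & Hc & E).
  assert (M : Cmod z = r) by (rewrite E; apply Cmod_polar; lra).
  rewrite M. split; [exact Hr|]. exists c. auto.
Qed.

Lemma sector_neq_0 th l h z : sector th l h z -> z <> 0.
Proof. intros H. apply Cmod_gt_0. apply (sector_Cmod _ _ _ _ H). Qed.

Lemma sector_weaken th l h l' h' z :
  sector th l h z -> l' <= l -> h <= h' -> sector th l' h' z.
Proof. intros (r & c & Hr & Hc & E) ? ?. exists r, c. repeat split; auto; lra. Qed.

Lemma sector_mult th l h l' h' z w :
  sector th l h z -> sector th l' h' w -> sector th (l + l') (h + h') (z * w)%C.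
Proof.
  intros (r & c & Hr & Hc & ->) (r' & c' & Hr' & Hc' & ->).
  exists (r * r'), (c + c'). repeat split; try lra; [nra|].
  rewrite Rmult_plus_distr_r, Cis_plus, RtoC_mult. ring.
Qed.

Lemma sector_pow th l h z n :
  sector th l h z -> sector th (INR n * l) (INR n * h) (z ^ n)%C.
Proof.
  intros (r & c & Hr & Hc & ->). exists (r ^ n), (INR n * c).
  pose proof (pos_INR n). repeat split; [apply pow_lt; exact Hr|nra|nra|].
  rewrite Cpow_mult_l, Cis_pow, RtoC_pow. do 2 f_equal. ring.
Qed.

Lemma sector_inv th l h z : sector th l h z -> sector th (- h) (- l) (/ z)%C.
Proof.
  intros (r & c & Hr & Hc & ->). exists (/ r), (- c).
  repeat split; try lra; [apply Rinv_0_lt_compat; exact Hr|].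
  assert (Hr' : RtoC r <> 0) by (intros F; apply RtoC_inj in F; lra).
  assert (Hi : (Cis (c * th) * Cis (- c * th))%C = 1).
  { rewrite <- Cis_plus. replace (c * th + - c * th) with 0 by ring. apply Cis_0. }
  assert (Hn : Cis (c * th) <> 0).
  { intros F. rewrite F, Cmult_0_l in Hi. apply RtoC_inj in Hi. lra. }
  rewrite RtoC_inv by lra. field_simplify; [|auto|auto].
  replace (1 / (RtoC r * Cis (c * th)))%C
    with (Cis (c * th) * Cis (- c * th) / (RtoC r * Cis (c * th)))%C
    by (rewrite Hi; reflexivity).
  field. auto.
Qed.

Lemma sector_real th r : 0 < r -> sector th 0 0 (RtoC r).
Proof.
  intros Hr. exists r, 0. repeat split; try lra. rewrite Rmult_0_l, Cis_0. ring.
Qed.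

Lemma sector_scal th l h r z : 0 < r -> sector th l h z -> sector th l h (RtoC r * z)%C.
Proof.
  intros Hr H. eapply sector_weaken; [exact (sector_mult _ _ _ _ _ _ _ (sector_real th r Hr) H)|lra|lra].
Qed.

(** For [0 < d < PI] the argument [t] of the sum satisfies [q sin t = r sin d] and
    [q sin (d - t) = sin d]. Both sines are positive, so [t] lies strictly between 0 and [d].
    Conjugation handles negative [d], and for [d = 0] any [k] serves. *)
Lemma one_plus_polar (r d : R) : 0 < r -> Rabs d < PI ->
  exists q k, 0 < q /\ 0 < k < 1 /\ (1 + RtoC r * Cis d)%C = (RtoC q * Cis (k * d))%C.
Proof.
  intros Hr.
  assert (P : forall d, 0 < d < PI -> exists q k, 0 < q /\ 0 < k < 1 /\
     (1 + RtoC r * Cis d)%C = (RtoC q * Cis (k * d))%C).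
  { clear d. intros d Hd.
    pose proof (sin_gt_0 d (proj1 Hd) (proj2 Hd)) as Sd.
    set (z := (1 + RtoC r * Cis d)%C).
    assert (Ez : z = (1 + r * cos d, r * sin d)).
    { unfold z, Cis, Cmult, Cplus, RtoC; simpl. f_equal; ring. }
    assert (Hz : z <> 0).
    { intros F. rewrite Ez in F. injection F as _ F. nra. }
    assert (Hm : 0 < Cmod z) by (apply Cmod_gt_0; exact Hz).
    destruct (Carg_polar z Hz) as [Hb E]. set (t := Carg z) in *. set (q := Cmod z) in *.
    assert (E1 : 1 + r * cos d = q * cos t /\ r * sin d = q * sin t).
    { rewrite Ez in E. unfold Cis, Cmult, RtoC in E; simpl in E. injection E as E1 E2.
      split; lra. }
    destruct E1 as [E1 E2].
    assert (St : 0 < sin t) by nra.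
    assert (Ht : 0 < t < PI).
    { split; [|lra]. destruct (Rlt_le_dec 0 t) as [|L]; [lra|exfalso].
      assert (0 <= sin (- t)) by (apply sin_ge_0; lra). rewrite sin_neg in *. lra. }
    assert (Sdt : q * sin (d - t) = sin d).
    { rewrite sin_minus. replace (q * (sin d * cos t - cos d * sin t))
        with (sin d * (q * cos t) - cos d * (q * sin t)) by ring.
      rewrite <- E1, <- E2. ring. }
    assert (Hdt : 0 < d - t).
    { destruct (Rlt_le_dec 0 (d - t)) as [|L]; [lra|exfalso].
      assert (0 <= sin (- (d - t))) by (apply sin_ge_0; lra). rewrite sin_neg in *. nra. }
    exists q, (t / d). repeat split; auto.
    - apply Rdiv_lt_0_compat; lra.
    - apply Rlt_div_l; lra.
    - replace (t / d * d) with t by (field; lra). exact E. }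
  intros Hd. destruct (Rtotal_order d 0) as [L|[-> |G]].
  - rewrite Rabs_left in Hd by exact L.
    destruct (P (- d)) as (q & k & Hq & Hk & E); [lra|].
    exists q, k. repeat split; try lra.
    unfold Cis, Cmult, Cplus, RtoC in *; simpl in *.
    replace (k * - d) with (- (k * d)) in E by ring.
    rewrite !cos_neg, !sin_neg in E. injection E as E1 E2. f_equal; lra.
  - exists (1 + r), (1 / 2). repeat split; try lra.
    rewrite Rmult_0_r, Cis_0, RtoC_plus. ring.
  - rewrite Rabs_right in Hd by lra. apply P. lra.
Qed.

Lemma sector_plus_strict th r c r' c' : 0 < r -> 0 < r' -> Rabs ((c' - c) * th) < PI ->
  exists q k, 0 < q /\ 0 < k < 1 /\
   (RtoC r * Cis (c * th) + RtoC r' * Cis (c' * th))%C =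
   (RtoC q * Cis ((c + k * (c' - c)) * th))%C.
Proof.
  intros Hr Hr' Hd.
  destruct (one_plus_polar (r' / r) ((c' - c) * th)) as (q & k & Hq & Hk & E);
    [apply Rdiv_lt_0_compat; lra|exact Hd|].
  exists (r * q), k. repeat split; try lra; [nra|].
  replace (c' * th) with (c * th + (c' - c) * th) by ring.
  replace ((c + k * (c' - c)) * th) with (c * th + k * ((c' - c) * th)) by ring.
  rewrite !Cis_plus, RtoC_mult.
  transitivity (RtoC r * Cis (c * th) * (RtoC q * Cis (k * ((c' - c) * th))))%C; [|ring].
  rewrite <- E, RtoC_div by lra.
  field. intros F; apply RtoC_inj in F; lra.
Qed.

Lemma sector_plus th l h l' h' z w : Rabs th <= PI ->
  (h' - l < 1) -> (h - l' < 1) -> sector th l h z -> sector th l' h' w ->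
  sector th (Rmin l l') (Rmax h h') (z + w)%C.
Proof.
  intros Ht H1 H2 (r & c & Hr & Hc & ->) (r' & c' & Hr' & Hc' & ->).
  destruct (sector_plus_strict th r c r' c') as (q & k & Hq & Hk & E); auto.
  { rewrite Rabs_mult. assert (Rabs (c' - c) < 1) by (apply Rabs_def1; lra).
    pose proof (Rabs_pos th). pose proof (Rabs_pos (c' - c)). pose proof PI_RGT_0. nra. }
  rewrite E. exists q, (c + k * (c' - c)).
  pose proof (Rmin_l l l'). pose proof (Rmin_r l l').
  pose proof (Rmax_l h h'). pose proof (Rmax_r h h').
  repeat split; auto; nra.
Qed.

Lemma sector_plus_in th l h z w : Rabs th <= PI -> h - l < 1 ->
  sector th l h z -> sector th l h w -> sector th l h (z + w)%C.
Proof.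
  intros Ht H Hz Hw. pose proof (sector_plus th l h l h z w Ht H H Hz Hw) as G.
  rewrite Rmin_left, Rmax_left in G by lra. exact G.
Qed.

(** * Reverse triangle inequality in a narrow sector *)

(** For [|u| = 1] the projection of [z] on the direction of the conjugate of [u] keeps at least the
    fraction [k] of [|z|]. The projection is additive, so for such terms the modulus of a sum is at
    least [k] times the sum of the moduli. *)
Definition leans (u : C) (k : R) (z : C) : Prop := k * Cmod z <= Re (u * z)%C.

Lemma Re_le_Cmod z : Re z <= Cmod z.
Proof. pose proof (re_le_Cmod z). pose proof (Rle_abs (Re z)). lra. Qed.

(** Here [b] is the axis of the sector and [w] a half-width, in units of [th]; since [|th| <= PI],
    angles to the axis are at most [w PI]. *)
Lemma sector_leans th l h b w k z : Rabs th <= PI -> 0 <= w <= 1 ->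
  b - w <= l -> h <= b + w -> k <= cos (w * PI) ->
  sector th l h z -> leans (Cis (- (b * th))) k z.
Proof.
  intros Ht Hw Hl Hh Hk Hz. apply sector_Cmod in Hz. destruct Hz as [Hm (c & Hc & E)].
  unfold leans. rewrite E at 2.
  replace (Cis (- (b * th)) * (RtoC (Cmod z) * Cis (c * th)))%C
    with (RtoC (Cmod z) * (Cis (- (b * th)) * Cis (c * th)))%C by ring.
  rewrite <- Cis_plus, re_scal_l. replace (- (b * th) + c * th) with ((c - b) * th) by ring.
  unfold Cis, Re at 1; simpl fst.
  enough (k <= cos ((c - b) * th)) by nra.
  pose proof PI_RGT_0 as HP. pose proof (Rabs_pos th).
  assert (Hcb : Rabs (c - b) <= w) by (apply Rabs_le; lra).
  pose proof (Rabs_pos (c - b)).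
  eapply Rle_trans; [exact Hk|]. apply cos_le_cos_abs;
    rewrite ?Rabs_mult, ?(Rabs_pos_eq w), ?(Rabs_pos_eq PI) by lra; nra.
Qed.

Lemma Re_mult_plus_lower u k z w a b : (k * a <= Re (u * z)%C) -> (k * b <= Re (u * w)%C) ->
  k * (a + b) <= Re (u * (z + w))%C.
Proof.
  intros. rewrite Cmult_plus_distr_l, re_plus. lra.
Qed.

Lemma Re_Cis_le_Cmod t z : Re (Cis t * z)%C <= Cmod z.
Proof.
  eapply Rle_trans; [apply Re_le_Cmod|]. rewrite Cmod_mult, Cmod_Cis. lra.
Qed.

Lemma Cmod_one_plus_sqr z : Cmod (1 + z) ^ 2 = 1 + 2 * Re z + Cmod z ^ 2.
Proof.
  rewrite !Cmod2_alt, re_plus. unfold Im, Re, Cplus, RtoC; simpl. ring.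
Qed.

(** * Principal roots in a sector and the root of the quintic *)

Lemma Cis_neg t : Cis (- t) = Cconj (Cis t).
Proof. unfold Cis, Cconj; simpl. rewrite cos_neg, sin_neg. reflexivity. Qed.

(** Unlike [Cis_inj], this restricts only the difference of the angles. It serves for five times an
    angle, which may leave [[-PI, PI[]. *)
Lemma Cis_inj_2PI (s t : R) : Rabs (s - t) < 2 * PI -> Cis s = Cis t -> s = t.
Proof.
  intros Hd E. apply Rabs_def2 in Hd.
  assert (H : Cis ((s - t) / 2) = Cis (- ((s - t) / 2))).
  { transitivity (Cis s * Cis (- ((s + t) / 2)))%C; [|rewrite E];
      rewrite <- Cis_plus; f_equal; field. }
  apply Cis_inj in H; lra.
Qed.

(** For [0 <= c <= 1] the angle [c th] lies between 0 and [th], hence in [[-PI, PI[] even when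
    [th = -PI]. It is therefore the value of [Carg], and the root just divides [c] by [n]. *)
Lemma Croot_sector th l h w n : (1 <= n)%nat -> - PI <= th < PI -> 0 <= l -> h <= 1 ->
  sector th l h w ->
  (Croot n w ^ n)%C = w /\ sector th (l / INR n) (h / INR n) (Croot n w).
Proof.
  intros Hn Hth Hl Hh (r & c & Hr & Hc & E).
  assert (Hn' : 1 <= INR n) by (change 1 with (INR 1); apply le_INR; exact Hn).
  assert (Hw : w <> 0) by (apply (sector_neq_0 th l h); exists r, c; auto).
  split.
  - apply (proj1 (Croot_spec n w _ Hn Hw)). reflexivity.
  - unfold Croot. destruct (Ceq_dec w 0) as [|_]; [contradiction|].
    exists (Rpower (Cmod w) (/ INR n)), (c / INR n).
    split; [apply exp_pos|]. split.
    + unfold Rdiv. assert (0 < / INR n) by (apply Rinv_0_lt_compat; lra).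
      split; apply Rmult_le_compat_r; lra.
    + do 2 f_equal. rewrite E, Carg_eq; [field; lra|exact Hr|].
      assert (0 <= c <= 1) by lra. split; [nra|].
      destruct (Rle_lt_dec th 0); nra.
Qed.

Lemma quintic_root_pos (th R0 : R) : 0 < th <= PI -> 0 < R0 ->
  exists s, sector th (1 / 5) (1 / 4) s /\ (s ^ 4 * (1 + s))%C = (RtoC R0 * Cis th)%C.
Proof.
  intros Hth HR.
  (* By the law of sines in the triangle with sides [1], [|s|], [|1 + s|], an angle [p]
     for [s] leaves [|s| = sin (th - 4 p) / sin (5 p - th)]. *)
  set (f := fun p => sin (th - 4 * p) ^ 4 * sin p - R0 * sin (5 * p - th) ^ 5).
  assert (S5 : 0 < sin (th / 5)) by (apply sin_gt_0; lra).
  assert (S4 : 0 < sin (th / 4)) by (apply sin_gt_0; lra).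
  (* A zero of [f] expresses [|s|^4 |1 + s| = R0] with denominators cleared. As [p] goes from
     [th / 5] to [th / 4], the length [|s|] runs from infinity down to 0, which explains the change
     of sign. *)
  assert (F5 : 0 < f (th / 5)).
  { unfold f. replace (th - 4 * (th / 5)) with (th / 5) by field.
    replace (5 * (th / 5) - th) with 0 by field. rewrite sin_0.
    pose proof (pow_lt _ 5 S5). simpl in *. lra. }
  assert (F4 : f (th / 4) < 0).
  { unfold f. replace (th - 4 * (th / 4)) with 0 by field.
    replace (5 * (th / 4) - th) with (th / 4) by field. rewrite sin_0.
    pose proof (pow_lt _ 5 S4). nra. }
  assert (Cf : continuity f) by (unfold f; reg).
  destruct (IVT_cor f (th / 5) (th / 4) Cf) as (p & Hp & Fp); [lra|nra|].
  assert (p <> th / 5) by (intros ->; lra).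
  assert (p <> th / 4) by (intros ->; lra).
  set (A := sin (5 * p - th)). set (B := sin (th - 4 * p)).
  assert (HA : 0 < A) by (apply sin_gt_0; lra).
  assert (HB : 0 < B) by (apply sin_gt_0; lra).
  assert (E : B ^ 4 * sin p = R0 * A ^ 5) by (unfold f in Fp; fold A B in Fp; lra).
  exists (RtoC (B / A) * Cis p)%C.
  assert (E1 : (1 + RtoC (B / A) * Cis p)%C = (RtoC (sin p / A) * Cis (th - 4 * p))%C).
  { unfold Cis, Cmult, Cplus, RtoC; simpl. f_equal.
    - assert (A = sin p * cos (th - 4 * p) - cos p * B).
      { unfold A, B. rewrite <- sin_minus. f_equal. ring. }
      apply (Rmult_eq_reg_l A); [|lra].
      transitivity (A + B * cos p); [field; lra|].
      transitivity (sin p * cos (th - 4 * p)); [lra|field; lra].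
    - fold B. field. lra. }
  split.
  - exists (B / A), (p / th). repeat split.
    + apply Rdiv_lt_0_compat; lra.
    + apply (Rmult_le_reg_r th); [lra|]. replace (p / th * th) with p by (field; lra). lra.
    + apply (Rmult_le_reg_r th); [lra|]. replace (p / th * th) with p by (field; lra). lra.
    + do 2 f_equal. field. lra.
  - rewrite E1, Cpow_mult_l, Cis_pow, <- RtoC_pow.
    replace th with (INR 4 * p + (th - 4 * p)) at 2 by (simpl; ring). rewrite Cis_plus.
    transitivity (RtoC ((B / A) ^ 4 * (sin p / A)) * (Cis (INR 4 * p) * Cis (th - 4 * p)))%C;
      [rewrite RtoC_mult; ring|].
    do 2 f_equal. apply (Rmult_eq_reg_l (A ^ 5)); [|apply pow_nonzero; lra].
    rewrite (Rmult_comm _ R0), <- E. field. lra.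
Qed.

(** Conjugation reduces negative [th] to positive [th]. At [th = 0] the triangle degenerates and a
    positive real root is found directly. *)
Lemma quintic_root (th R0 : R) : - PI <= th <= PI -> 0 < R0 ->
  exists s, sector th (1 / 5) (1 / 4) s /\ (s ^ 4 * (1 + s))%C = (RtoC R0 * Cis th)%C.
Proof.
  intros Hth HR. destruct (Rtotal_order th 0) as [L|[-> |G]].
  - destruct (quintic_root_pos (- th) R0) as (s & (r & c & Hr & Hc & Es) & E); [lra|exact HR|].
    exists (Cconj s). split.
    + exists r, c. repeat split; try lra. rewrite Es, Cmult_conj.
      rewrite <- Cis_neg. f_equal; [|f_equal; ring].
      unfold Cconj, RtoC; simpl. f_equal; ring.
    + apply (f_equal Cconj) in E. rewrite !Cmult_conj, Cplus_conj, Cpow_conj, <- Cis_neg in E.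
      rewrite Ropp_involutive in E.
      assert (Q : forall x, Cconj (RtoC x) = RtoC x)
        by (intros x; unfold Cconj, RtoC; simpl; f_equal; ring).
      rewrite !Q in E. exact E.
  - set (f := fun x => x ^ 4 * (1 + x) - R0).
    assert (Cf : continuity f) by (unfold f; reg).
    destruct (IVT_cor f 0 (1 + R0) Cf) as (x & Hx & Fx); [lra| |].
    + assert (f 0 <= 0) by (unfold f; lra).
      assert (0 <= f (1 + R0)); [|nra].
      unfold f. pose proof (pow_R1_Rle (1 + R0) 4). nra.
    + unfold f in Fx. assert (x <> 0) by (intros ->; lra).
      exists (RtoC x). split.
      * exists x, (1 / 5). repeat split; try lra. rewrite Rmult_0_r, Cis_0. ring.
      * rewrite Cis_0, <- RtoC_pow, <- RtoC_plus, <- !RtoC_mult. f_equal. lra.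
  - apply quintic_root_pos; lra.
Qed.

(** * The iteration *)

(** The polynomial added to [W] is [(m + 1/5)^5 - m^5 - m^4]: completing the fifth power in
    [s^5 + s^4 = W] is the origin of the shift by 1/5. *)
Definition radicand (W m : C) : C :=
  (W + 2 / 5 * m ^ 3 + 2 / 25 * m ^ 2 + 1 / 125 * m + 1 / 3125)%C.

(* [W] and [1/3125] may be opposite; adding [m / 125] to [W] first moves it strictly
   inside the half-plane, after which no partial sum can vanish. *)
Lemma radicand_sector th W m : Rabs th <= PI -> sector th 1 1 W ->
  sector th (1 / 5) (1 / 4) m -> sector th 0 1 (radicand W m).
Proof.
  intros Hth HW Hm.
  assert (H3 : sector th (3 / 5) (3 / 4) (RtoC (2 / 5) * m ^ 3)%C).
  { apply sector_scal; [lra|]. eapply sector_weaken; [exact (sector_pow _ _ _ _ 3 Hm)| |];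
    simpl; lra. }
  assert (H2 : sector th (2 / 5) (2 / 4) (RtoC (2 / 25) * m ^ 2)%C).
  { apply sector_scal; [lra|]. eapply sector_weaken; [exact (sector_pow _ _ _ _ 2 Hm)| |];
    simpl; lra. }
  assert (H1 : sector th (1 / 5) (1 / 4) (RtoC (1 / 125) * m)%C)
    by (apply sector_scal; [lra|exact Hm]).
  assert (HS : exists h, 3 / 4 <= h < 1 /\ sector th (1 / 5) h (W + RtoC (1 / 125) * m)%C).
  { destruct HW as (r & c & Hr & Hc1 & ->). destruct H1 as (r' & c' & Hr' & Hc' & ->).
    replace c with 1 in * by lra.
    destruct (sector_plus_strict th r 1 r' c') as (q & k & Hq & Hk & E); auto.
    { rewrite Rabs_mult. assert (Rabs (c' - 1) < 1) by (apply Rabs_def1; lra).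
      pose proof (Rabs_pos th). pose proof (Rabs_pos (c' - 1)). pose proof PI_RGT_0. nra. }
    exists (Rmax (3 / 4) (1 + k * (c' - 1))). split.
    - split; [apply Rmax_l|]. apply Rmax_lub_lt; nra.
    - rewrite E. exists q, (1 + k * (c' - 1)).
      pose proof (Rmax_r (3 / 4) (1 + k * (c' - 1))). repeat split; auto; nra. }
  destruct HS as (h & Hh & HS).
  unfold radicand. rewrite !Cdiv_RtoC by lra.
  replace (W + RtoC (2 / 5) * m ^ 3 + RtoC (2 / 25) * m ^ 2 + RtoC (1 / 125) * m
           + RtoC (1 / 3125))%C
    with ((W + RtoC (1 / 125) * m) + RtoC (2 / 5) * m ^ 3 + RtoC (2 / 25) * m ^ 2
           + RtoC (1 / 3125))%C by ring.
  apply sector_weaken with 0 h; [|lra|lra].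
  apply sector_plus_in; [exact Hth|lra| |
    apply sector_weaken with 0 0; [apply sector_real; lra|lra|lra]].
  apply sector_weaken with (1 / 5) h; [|lra|lra].
  apply sector_plus_in; [exact Hth|lra| |eapply sector_weaken; [exact H2|lra|lra]].
  apply sector_plus_in; [exact Hth|lra|exact HS|eapply sector_weaken; [exact H3|lra|lra]].
Qed.

Lemma radicand_fixed W s : (s ^ 4 * (1 + s))%C = W -> radicand W s = ((s + 1 / 5) ^ 5)%C.
Proof.
  intros <-. unfold radicand. field.
Qed.

Lemma radicand_minus W m s : (radicand W m - radicand W s =
  (m - s) * (2 / 5 * (m ^ 2 + m * s + s ^ 2) + 2 / 25 * (m + s) + 1 / 125))%C.
Proof. unfold radicand. ring. Qed.

(** This makes [s + 1/5] the principal fifth root of its fifth power. A priori its multiplier [c] is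
    only at most 1/4, while the fifth power has a multiplier [c5] in [[0, 1]]. Since
    [|5 c - c5| <= 5/4], the angles [5 c th] and [c5 th] differ by less than [2 PI], hence agree. *)
Lemma shifted_root_sector th W s : Rabs th <= PI -> sector th 1 1 W ->
  sector th (1 / 5) (1 / 4) s -> (s ^ 4 * (1 + s))%C = W ->
  sector th 0 (1 / 5) (s + 1 / 5)%C.
Proof.
  intros Hth HW Hs E. pose proof (radicand_sector th W s Hth HW Hs) as H5.
  rewrite (radicand_fixed _ _ E) in H5.
  assert (H : sector th 0 (1 / 4) (s + 1 / 5)%C).
  { rewrite Cdiv_RtoC by lra.
    apply sector_plus_in; [exact Hth|lra| |];
      [eapply sector_weaken; [exact Hs|lra|lra]|].
    apply sector_weaken with 0 0; [apply sector_real; lra|lra|lra]. }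
  destruct H as (r & c & Hr & Hc & Ez). destruct H5 as (r5 & c5 & Hr5 & Hc5 & E5).
  assert (Em : r5 = r ^ 5).
  { apply (f_equal Cmod) in E5. rewrite Cmod_polar, Cmod_pow, Ez, Cmod_polar in E5; lra. }
  rewrite Ez, Cpow_mult_l, Cis_pow, <- RtoC_pow, <- Em in E5.
  assert (Hr5' : RtoC r5 <> 0) by (intros F; apply RtoC_inj in F; lra).
  apply (f_equal (fun u => (/ RtoC r5 * u)%C)) in E5.
  rewrite !Cmult_assoc, Cinv_l, !Cmult_1_l in E5 by exact Hr5'.
  assert (Hd : INR 5 * (c * th) = c5 * th).
  { apply Cis_inj_2PI; [|exact E5]. replace (INR 5 * (c * th) - c5 * th)
      with ((5 * c - c5) * th) by (simpl; ring).
    rewrite Rabs_mult. pose proof (Rabs_pos th). pose proof PI_RGT_0.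
    assert (Rabs (5 * c - c5) <= 5 / 4) by (apply Rabs_le; lra). nra. }
  exists r, (c5 / 5). repeat split; [exact Hr|lra|lra|].
  rewrite Ez. do 2 f_equal. simpl in Hd. lra.
Qed.

(** The invariant is that [1 + z] has multiplier in [[0, 1/5]]. Then [W / (1 + z)] has multiplier in
    [[4/5, 1]] and its fourth root in [[1/5, 1/4]]; the fifth root of the radicand is in [[0, 1/5]],
    and adding the real 4/5 to it gives [1 + t] in the same sector. *)
Lemma iteration_step a th z : - PI <= th < PI -> sector th 1 1 (2 * lam a)%C ->
  sector th 0 (1 / 5) (1 + z)%C ->
  let m := m_of a z in
  let t := (Croot 5 (radicand (2 * lam a) m) - 1 / 5)%C in
  sector th (1 / 5) (1 / 4) m /\ (m ^ 4 * (1 + z))%C = (2 * lam a)%C /\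
  sector th 0 (1 / 5) (t + 1 / 5)%C /\ ((t + 1 / 5) ^ 5)%C = radicand (2 * lam a) m /\
  sector th 0 (1 / 5) (1 + t)%C.
Proof.
  intros Hth HW Hz m t. set (W := (2 * lam a)%C) in *.
  assert (Ha : Rabs th <= PI) by (apply Rabs_le; lra).
  destruct (Croot_sector th (4 / 5) 1 (W / (1 + z))%C 4) as [Em Sm]; [lia|lra|lra|lra| |].
  { unfold Cdiv. eapply sector_weaken; [exact (sector_mult _ _ _ _ _ _ _ HW (sector_inv _ _ _ _ Hz))|lra|lra]. }
  change (Croot 4 (W / (1 + z))) with m in Em, Sm.
  assert (Hm : sector th (1 / 5) (1 / 4) m)
    by (eapply sector_weaken; [exact Sm|simpl; lra|simpl; lra]).
  destruct (Croot_sector th 0 1 (radicand W m) 5) as [Et St];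
    [lia|lra|lra|lra|apply radicand_sector; auto|].
  assert (Q : (t + 1 / 5)%C = Croot 5 (radicand W m)) by (unfold t; ring).
  assert (Ht : sector th 0 (1 / 5) (t + 1 / 5)%C).
  { rewrite Q. eapply sector_weaken; [exact St|simpl; lra|simpl; lra]. }
  split; [exact Hm|]. split; [|split; [exact Ht|split]].
  - rewrite Em. field. apply (sector_neq_0 _ _ _ _ Hz).
  - rewrite Q. exact Et.
  - replace (1 + t)%C with ((t + 1 / 5) + RtoC (4 / 5))%C.
    + apply sector_plus_in; [exact Ha|lra|exact Ht|].
      apply sector_weaken with 0 0; [apply sector_real; lra|lra|lra].
    + rewrite RtoC_div by lra. field.
Qed.

Lemma zseq_S a k : zseq a (S k) = (Croot 5 (radicand (2 * lam a) (m_of a (zseq a k))) - 1 / 5)%C.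
Proof. reflexivity. Qed.

Lemma zseq_sector a th k : - PI <= th < PI -> sector th 1 1 (2 * lam a)%C ->
  sector th 0 (1 / 5) (1 + zseq a 0)%C -> sector th 0 (1 / 5) (1 + zseq a k)%C.
Proof.
  intros Hth HW H0. induction k as [|k IH]; [exact H0|].
  rewrite zseq_S. apply (iteration_step a th (zseq a k)); auto.
Qed.

Lemma alpha_sqr : 4 * alpha ^ 2 = 2 + sqrt 2.
Proof.
  unfold alpha. pose proof (sqrt_pos 2). rewrite pow2_sqrt by lra. field.
Qed.

Lemma alpha_pos : 0 < alpha.
Proof. apply sqrt_lt_R0. pose proof (sqrt_pos 2). lra. Qed.

(** The ninth power removes the exponent 2/9: [r^9 = |lam|^2 / alpha^2], with [|W| = 2 |lam|] and
    [4 alpha^2 = 2 + sqrt 2]. *)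
Lemma zseq_0_polar (a : C) : a <> 0 ->
  exists r, 0 < r /\ zseq a 0 = (RtoC r * Cis (1 / 5 * Carg (2 * lam a)))%C /\
  (2 + sqrt 2) * r ^ 9 = Cmod (2 * lam a) ^ 2.
Proof.
  intros Ha. set (W := (2 * lam a)%C).
  assert (H2 : forall x : R, x <> 0 -> RtoC x <> 0) by (intros x Hx F; apply RtoC_inj in F; lra).
  assert (EW : W = (- a ^ 4)%C) by (unfold W, lam; field; apply H2; lra).
  assert (HW : W <> 0).
  { rewrite EW. intros F. apply (Cpow_nz a 4 Ha).
    replace (a ^ 4)%C with (- (- a ^ 4))%C by ring. rewrite F. ring. }
  assert (HR : 0 < Cmod W) by (apply Cmod_gt_0; exact HW).
  destruct (Carg_polar W HW) as [Hb E].
  assert (El : lam a = (RtoC (Cmod W / 2) * Cis (Carg W))%C).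
  { rewrite RtoC_div by lra. transitivity (W / 2)%C; [unfold W; field|].
    rewrite E at 1. field. }
  assert (Ml : Cmod (lam a) = Cmod W / 2) by (rewrite El; apply Cmod_polar; lra).
  pose proof alpha_pos as Hal.
  set (r := Rpower (Cmod (lam a) / alpha) (2 / 9)).
  exists r. split; [apply exp_pos|]. split.
  - change (zseq a 0) with (RtoC r * Croot 5 (lam a / RtoC (Cmod (lam a))))%C.
    f_equal. replace (lam a / RtoC (Cmod (lam a)))%C with (Cis (Carg W)).
    + assert (N : Cis (Carg W) <> 0) by (apply Cmod_gt_0; rewrite Cmod_Cis; lra).
      unfold Croot. destruct (Ceq_dec (Cis (Carg W)) 0) as [|_]; [contradiction|].
      replace (Carg (Cis (Carg W))) with (Carg W).
      * rewrite Cmod_Cis. unfold Rpower. rewrite ln_1, Rmult_0_r, exp_0, Cmult_1_l.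
        f_equal. simpl. field.
      * rewrite <- (Carg_eq 1 (Carg W)) at 1; [f_equal; ring|lra|exact Hb].
    + rewrite Ml, El. field. apply H2. lra.
  - assert (Hp : 0 < Cmod (lam a) / alpha) by (apply Rdiv_lt_0_compat; lra).
    unfold r. rewrite <- Rpower_pow by apply exp_pos. rewrite Rpower_mult.
    replace (2 / 9 * INR 9) with (INR 2) by (simpl; field).
    rewrite Rpower_pow, <- alpha_sqr, Ml by exact Hp. field. lra.
Qed.

(** * Error of the two roots *)

Lemma cos_PI5 : 0.8 <= cos (PI / 5).
Proof. pose proof (cos_lower (PI / 5)). pose proof PI_lt_315. pose proof PI_RGT_0. nra. Qed.

Lemma cos_2PI5 : 0.28 <= cos (2 * (PI / 5)).
Proof. rewrite cos_2a_cos. pose proof cos_PI5. nra. Qed.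

Lemma cos_3PI40 : 0.97 <= cos (3 / 40 * PI).
Proof. pose proof (cos_lower (3 / 40 * PI)). pose proof PI_lt_315. pose proof PI_RGT_0. nra. Qed.

Lemma sqrt2_bounds : 1.4142 < sqrt 2 < 1.4143.
Proof.
  pose proof (sqrt_pos 2). pose proof (pow2_sqrt 2). split; nra.
Qed.

Lemma sector_Re_lower th s : Rabs th <= PI -> sector th (1 / 5) (1 / 4) s ->
  sqrt 2 * Cmod s <= 2 * Re s.
Proof.
  intros Hth Hs. apply sector_Cmod in Hs. destruct Hs as (Hm & c & Hc & E).
  rewrite E at 2. rewrite re_scal_l. unfold Cis; simpl.
  assert (H : cos (PI / 4) <= cos (c * th)).
  { pose proof PI_RGT_0. pose proof (Rabs_pos th). apply cos_le_cos_abs;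
      rewrite (Rabs_pos_eq (PI / 4)) by lra; [|lra].
    rewrite Rabs_mult, (Rabs_pos_eq c) by lra.
    apply Rle_trans with (1 / 4 * PI); [apply Rmult_le_compat|]; lra. }
  rewrite cos_PI4 in H. pose proof sqrt2_bounds.
  assert (Q : 1 / sqrt 2 = sqrt 2 / 2).
  { apply (Rmult_eq_reg_r (sqrt 2)); [|lra]. rewrite <- (sqrt_sqrt 2) at 4 by lra. field. lra. }
  rewrite Q in H. nra.
Qed.

Lemma Cmod_one_plus_lower th s : Rabs th <= PI -> sector th (1 / 5) (1 / 4) s ->
  1 + sqrt 2 * Cmod s + Cmod s ^ 2 <= Cmod (1 + s) ^ 2.
Proof.
  intros Hth Hs. rewrite Cmod_one_plus_sqr. pose proof (sector_Re_lower _ _ Hth Hs). lra.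
Qed.

(** All four monomials lie in the sector [[3/5, 3/4]], of axis 27/40 and half-width 3/40. *)
Lemma sum4_lower th m s : Rabs th <= PI ->
  sector th (1 / 5) (1 / 4) m -> sector th (1 / 5) (1 / 4) s ->
  0.97 * (Cmod m ^ 3 + Cmod m ^ 2 * Cmod s + Cmod m * Cmod s ^ 2 + Cmod s ^ 3)
  <= Cmod (m ^ 3 + m ^ 2 * s + m * s ^ 2 + s ^ 3)%C.
Proof.
  intros Hth Hm Hs.
  eapply Rle_trans; [|apply (Re_Cis_le_Cmod (- (27 / 40 * th)))].
  assert (L : forall z, sector th (3 / 5) (3 / 4) z -> 0.97 * Cmod z <= Re (Cis (- (27 / 40 * th)) * z)%C).
  { intros z Hz. apply (sector_leans th (3 / 5) (3 / 4) (27 / 40) (3 / 40)); auto; try lra.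
    apply cos_3PI40. }
  pose proof (sector_pow _ _ _ _ 2 Hm) as Hm2. pose proof (sector_pow _ _ _ _ 2 Hs) as Hs2.
  pose proof (sector_pow _ _ _ _ 3 Hm) as Hm3. pose proof (sector_pow _ _ _ _ 3 Hs) as Hs3.
  pose proof (sector_mult _ _ _ _ _ _ _ Hm2 Hs) as H21.
  pose proof (sector_mult _ _ _ _ _ _ _ Hm Hs2) as H12.
  simpl INR in *.
  rewrite <- !Cmod_pow, <- !Cmod_mult.
  repeat apply (Re_mult_plus_lower _ 0.97); try assumption; apply L;
    (eapply sector_weaken; [eassumption|lra|lra]).
Qed.

Lemma fourth_root_error th m s z : Rabs th <= PI ->
  sector th (1 / 5) (1 / 4) m -> sector th (1 / 5) (1 / 4) s ->
  (m ^ 4 * (1 + z))%C = (s ^ 4 * (1 + s))%C ->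
  0.97 * (Cmod m ^ 3 + Cmod m ^ 2 * Cmod s + Cmod m * Cmod s ^ 2 + Cmod s ^ 3)
  * (Cmod (m - s) * Cmod (1 + z)) <= Cmod s ^ 4 * Cmod (s - z).
Proof.
  intros Hth Hm Hs E. pose proof (sum4_lower th m s Hth Hm Hs) as H.
  assert (F : ((m ^ 3 + m ^ 2 * s + m * s ^ 2 + s ^ 3) * ((m - s) * (1 + z)) = s ^ 4 * (s - z))%C).
  { transitivity (m ^ 4 * (1 + z) - s ^ 4 * (1 + z))%C; [ring|]. rewrite E. ring. }
  apply (f_equal Cmod) in F. rewrite !Cmod_mult, Cmod_pow in F.
  rewrite <- F. apply Rmult_le_compat_r; [|exact H].
  apply Rmult_le_pos; apply Cmod_ge_0.
Qed.

(* [v^5 - 1 = (v - 1) S] where [S = 1 + v + v^2 + v^3 + v^4]; the sector gives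
   [|S| >= 3.16 |v|^2], and two rounds of [|S - 5| <= 10.5 |v - 1|] improve this to 4.7. *)
Lemma fifth_root_of_unity_error th v : Rabs th <= PI -> sector th (- (1 / 5)) (1 / 5) v ->
  Cmod (v ^ 5 - 1) <= 0.12 -> 4.7 * Cmod (v - 1) <= Cmod (v ^ 5 - 1).
Proof.
  intros Hth Hv HE. apply sector_Cmod in Hv. destruct Hv as (Hr & c & Hc & Ev).
  set (r := Cmod v) in *. set (E := Cmod (v ^ 5 - 1)) in *. set (e := Cmod (v - 1)) in *.
  set (S := (1 + v + v ^ 2 + v ^ 3 + v ^ 4)%C).
  assert (HS : e * Cmod S = E).
  { unfold e, E. rewrite <- Cmod_mult. f_equal. unfold S. ring. }
  assert (He0 : 0 <= e) by apply Cmod_ge_0.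
  assert (Hr97 : 0.97 <= r).
  { assert (H1 : 1 <= r ^ 5 + E).
    { unfold r, E. rewrite <- Cmod_pow. rewrite <- Cmod_1 at 1.
      replace (RtoC 1) with (v ^ 5 + - (v ^ 5 - 1))%C at 1 by ring.
      eapply Rle_trans; [apply Cmod_triangle|]. rewrite Cmod_opp. lra. }
    destruct (Rle_lt_dec 0.97 r) as [|L]; [assumption|exfalso].
    assert (r ^ 5 <= 0.97 ^ 5) by (apply pow_incr; lra). lra. }
  assert (Hr1 : r <= 1 + e).
  { unfold r, e. replace v with (1 + (v - 1))%C at 1 by ring.
    eapply Rle_trans; [apply Cmod_triangle|]. rewrite Cmod_1. lra. }
  assert (Hcrude : 2.97 <= Cmod S).
  { set (d := c * th) in *.
    assert (Hd : Rabs d <= PI / 5).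
    { unfold d. rewrite Rabs_mult. assert (Rabs c <= 1 / 5) by (apply Rabs_le; lra).
      pose proof (Rabs_pos c). pose proof (Rabs_pos th).
      apply Rle_trans with (1 / 5 * PI); [apply Rmult_le_compat|]; lra. }
    pose proof PI_RGT_0 as HP.
    assert (C1 : 0.8 <= cos d).
    { eapply Rle_trans; [apply cos_PI5|]. apply cos_le_cos_abs;
        rewrite (Rabs_pos_eq (PI / 5)); lra. }
    assert (C2 : 0.28 <= cos (2 * d)).
    { eapply Rle_trans; [apply cos_2PI5|]. apply cos_le_cos_abs;
        rewrite ?Rabs_mult, ?(Rabs_pos_eq 2), (Rabs_pos_eq (PI / 5)); lra. }
    eapply Rle_trans; [|apply (Re_Cis_le_Cmod (- (2 * d)))].
    (* Rotating by [-2 d] centres the five powers at the angles [-2 d, ..., 2 d]. Opposite terms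
       pair up, and [r + r^3] and [1 + r^4] are each at least [2 r^2], so the projection is at least
       [(1 + 1.6 + 0.56) r^2]. *)
    assert (T : forall k, Re (Cis (- (2 * d)) * v ^ k)%C = r ^ k * cos (INR k * d - 2 * d)).
    { intros k. rewrite Ev, Cpow_mult_l, Cis_pow, <- RtoC_pow.
      replace (Cis (- (2 * d)) * (RtoC (r ^ k) * Cis (INR k * d)))%C
        with (RtoC (r ^ k) * (Cis (- (2 * d)) * Cis (INR k * d)))%C by ring.
      rewrite <- Cis_plus, re_scal_l. unfold Cis; simpl. do 2 f_equal. ring. }
    unfold S. rewrite !Cmult_plus_distr_l, !re_plus.
    replace (RtoC 1) with (v ^ 0)%C by reflexivity. replace v with (v ^ 1)%C at 2 by ring.
    rewrite !T. simpl INR.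
    replace (0 * d - 2 * d) with (- (2 * d)) by ring.
    replace (1 * d - 2 * d) with (- d) by ring.
    replace ((1 + 1) * d - 2 * d) with 0 by ring.
    replace ((1 + 1 + 1) * d - 2 * d) with d by ring.
    replace ((1 + 1 + 1 + 1) * d - 2 * d) with (2 * d) by ring.
    rewrite !cos_neg, cos_0.
    assert (H1 : 2 * r ^ 2 <= r ^ 1 + r ^ 3).
    { assert (0 <= r * (r - 1) ^ 2) by (apply Rmult_le_pos; [lra|apply pow2_ge_0]). lra. }
    assert (H2 : 2 * r ^ 2 <= r ^ 0 + r ^ 4).
    { pose proof (pow2_ge_0 (r ^ 2 - 1)). lra. }
    assert (0.94 <= r ^ 2) by nra.
    assert (G1 : 2 * r ^ 2 * 0.8 <= (r ^ 1 + r ^ 3) * cos d)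
      by (apply Rmult_le_compat; lra).
    assert (G2 : 2 * r ^ 2 * 0.28 <= (r ^ 0 + r ^ 4) * cos (2 * d))
      by (apply Rmult_le_compat; lra).
    lra. }
  assert (Hfine : 5 - 10.5 * e <= Cmod S \/ 0.0405 < e).
  { destruct (Rlt_le_dec 0.0405 e) as [|L]; [right; assumption|left].
    assert (H5 : 5 <= Cmod S + e * Cmod (v ^ 3 + 2 * v ^ 2 + 3 * v + 4)%C).
    { unfold e. rewrite <- Cmod_mult.
      replace 5 with (Cmod 5) by (rewrite Cmod_R; apply Rabs_pos_eq; lra).
      replace (RtoC 5) with (S + - ((v - 1) * (v ^ 3 + 2 * v ^ 2 + 3 * v + 4)))%C
        by (unfold S; ring).
      eapply Rle_trans; [apply Cmod_triangle|]. rewrite Cmod_opp. lra. }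
    assert (H10 : Cmod (v ^ 3 + 2 * v ^ 2 + 3 * v + 4)%C <= 10.5); [|nra].
    eapply Rle_trans; [apply Cmod_triangle|]. eapply Rle_trans;
      [apply Rplus_le_compat_r; eapply Rle_trans; [apply Cmod_triangle|
       apply Rplus_le_compat_r; apply Cmod_triangle]|].
    rewrite !Cmod_mult, !Cmod_pow, !Cmod_R, !Rabs_pos_eq by lra. fold r.
    assert (r ^ 2 <= 1.0405 ^ 2) by (apply pow_incr; lra).
    assert (r ^ 3 <= 1.0405 ^ 3) by (apply pow_incr; lra). lra. }
  (* The two rounds: [0.12 / 2.97 < 0.0405], so [|S| >= 4.57]; then [0.12 / 4.57 < 0.0264], so
     [|S| >= 5 - 10.5 * 0.0264 > 4.7]. *)
  assert (e <= 0.0405) by nra.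
  destruct Hfine as [Hfine|]; [|lra].
  assert (4.57 <= Cmod S) by lra.
  assert (e <= 0.0264) by nra.
  nra.
Qed.

Lemma fifth_root_error th x w : Rabs th <= PI ->
  sector th 0 (1 / 5) x -> sector th 0 (1 / 5) w ->
  Cmod (x ^ 5 - w ^ 5) <= 0.12 * Cmod w ^ 5 ->
  4.7 * Cmod w ^ 4 * Cmod (x - w) <= Cmod (x ^ 5 - w ^ 5).
Proof.
  intros Hth Hx Hw HE.
  pose proof (sector_neq_0 _ _ _ _ Hw) as Hw0.
  assert (Hm : 0 < Cmod w) by (apply Cmod_gt_0; exact Hw0).
  assert (E5 : Cmod (x ^ 5 - w ^ 5) = Cmod w ^ 5 * Cmod ((x / w) ^ 5 - 1)).
  { rewrite <- Cmod_pow, <- Cmod_mult. f_equal. field. exact Hw0. }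
  assert (E1 : Cmod (x - w) = Cmod w * Cmod (x / w - 1)).
  { rewrite <- Cmod_mult. f_equal. field. exact Hw0. }
  assert (H5 : 0 < Cmod w ^ 5) by (apply pow_lt; exact Hm).
  rewrite E5 in HE |- *. rewrite E1.
  replace (4.7 * Cmod w ^ 4 * (Cmod w * Cmod (x / w - 1)))
    with (Cmod w ^ 5 * (4.7 * Cmod (x / w - 1))) by ring.
  apply Rmult_le_compat_l; [lra|].
  apply (fifth_root_of_unity_error th); [exact Hth| |nra].
  unfold Cdiv. eapply sector_weaken; [exact (sector_mult _ _ _ _ _ _ _ Hx (sector_inv _ _ _ _ Hw))|lra|lra].
Qed.

(* With [x = |s|]: [qbound x] bounds the cofactor of [m - s] in [radicand_minus] when
   [|m| <= 1.01 x], and [nlow x <= |s + 1/5|^2] because [s] has argument at most [PI / 4]. *)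
Definition qbound (x : R) : R := 1.011 * (1.2 * x ^ 2 + 0.16 * x + 0.008).
Definition nlow (x : R) : R := 0.04 + 0.2828 * x + x ^ 2.

Lemma qbound_pos x : 0 <= x -> 0 < qbound x.
Proof. intros. unfold qbound. nra. Qed.

Lemma Cmod_RtoC_pos (x : R) : 0 <= x -> Cmod (RtoC x) = x.
Proof. intros. rewrite Cmod_R. apply Rabs_pos_eq. assumption. Qed.

Lemma nlow_le_Cmod th s : Rabs th <= PI -> sector th (1 / 5) (1 / 4) s ->
  nlow (Cmod s) <= Cmod (s + 1 / 5) ^ 2.
Proof.
  intros Hth Hs. pose proof (sector_Re_lower _ _ Hth Hs). pose proof sqrt2_bounds.
  pose proof (Cmod_ge_0 s). unfold nlow.
  rewrite Cdiv_RtoC by lra.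
  assert (E : Cmod (s + RtoC (1 / 5)) ^ 2 = Cmod s ^ 2 + 2 / 5 * Re s + 1 / 25).
  { rewrite !Cmod2_alt. unfold Re, Im, Cplus, RtoC; simpl. field. }
  nra.
Qed.

(** The half of a step that leads from [m] to [t], shared by the first step and the contraction. As
    [nlow] squared is at most [|s + 1/5|^4] and [|s| <= |s + 1/5|], the condition [p <= 0.12]
    supplies the smallness that [fifth_root_error] requires. *)
Lemma root_error th W m s t p : Rabs th <= PI -> sector th 1 1 W ->
  sector th (1 / 5) (1 / 4) s -> (s ^ 4 * (1 + s))%C = W ->
  sector th 0 (1 / 5) (t + 1 / 5)%C -> ((t + 1 / 5) ^ 5)%C = radicand W m ->
  Cmod m <= 1.01 * Cmod s -> p <= 0.12 ->
  Cmod (m - s) * qbound (Cmod s) <= p * Cmod s * nlow (Cmod s) ^ 2 ->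
  4.7 * Cmod (t - s) <= p * Cmod s.
Proof.
  intros Hth HW Hs Es Ht Et Hm Hp HP.
  pose proof (shifted_root_sector th W s Hth HW Hs Es) as Hw.
  pose proof (nlow_le_Cmod _ _ Hth Hs) as Hn.
  destruct (sector_Cmod _ _ _ _ Hs) as [Hs0 _]. destruct (sector_Cmod _ _ _ _ Hw) as [Hw0 _].
  assert (Hle : Cmod s <= Cmod (s + 1 / 5)).
  { unfold nlow in Hn. apply Rnot_lt_le. intros L. nra. }
  set (w := (s + 1 / 5)%C) in *. set (sg := Cmod s) in *.
  assert (E : ((t + 1 / 5) ^ 5 - w ^ 5)%C
     = ((m - s) * (2 / 5 * (m ^ 2 + m * s + s ^ 2) + 2 / 25 * (m + s) + 1 / 125))%C).
  { rewrite Et, <- (radicand_minus W), (radicand_fixed W s Es). reflexivity. }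
  assert (HQ : Cmod ((t + 1 / 5) ^ 5 - w ^ 5) <= Cmod (m - s) * qbound sg).
  { rewrite E, Cmod_mult. apply Rmult_le_compat_l; [apply Cmod_ge_0|].
    rewrite !Cdiv_RtoC by lra.
    eapply Rle_trans; [apply Cmod_triangle|].
    eapply Rle_trans; [apply Rplus_le_compat_r, Cmod_triangle|].
    rewrite !Cmod_mult, !Cmod_RtoC_pos by lra.
    assert (Cmod (m + s) <= Cmod m + sg) by apply Cmod_triangle.
    assert (Cmod (m ^ 2 + m * s + s ^ 2) <= Cmod m ^ 2 + Cmod m * sg + sg ^ 2).
    { eapply Rle_trans; [apply Cmod_triangle|].
      eapply Rle_trans; [apply Rplus_le_compat_r, Cmod_triangle|].
      rewrite Cmod_mult, !Cmod_pow. fold sg. lra. }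
    pose proof (Cmod_ge_0 m). unfold qbound.
    assert (Cmod m ^ 2 <= (1.01 * sg) ^ 2) by (apply pow_incr; lra). nra. }
  assert (Hn0 : 0 < nlow sg) by (unfold nlow; nra).
  assert (Hp0 : 0 <= p).
  { pose proof (qbound_pos sg). pose proof (Cmod_ge_0 (m - s)).
    apply Rnot_lt_le. intros L. assert (0 < sg * nlow sg ^ 2) by (apply Rmult_lt_0_compat; [lra|apply pow_lt; lra]).
    nra. }
  assert (Hn4 : nlow sg ^ 2 <= Cmod w ^ 4).
  { replace (Cmod w ^ 4) with ((Cmod w ^ 2) ^ 2) by ring. apply pow_incr. lra. }
  assert (Hw4 : 0 < Cmod w ^ 4) by (apply pow_lt; exact Hw0).
  assert (HE : Cmod ((t + 1 / 5) ^ 5 - w ^ 5) <= p * sg * Cmod w ^ 4).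
  { eapply Rle_trans; [exact HQ|]. eapply Rle_trans; [exact HP|].
    apply Rmult_le_compat_l; [nra|exact Hn4]. }
  assert (H12 : p * sg * Cmod w ^ 4 <= 0.12 * Cmod w ^ 5).
  { replace (0.12 * Cmod w ^ 5) with (0.12 * Cmod w * Cmod w ^ 4) by ring.
    apply Rmult_le_compat_r; [lra|]. apply Rmult_le_compat; lra. }
  pose proof (fifth_root_error th (t + 1 / 5)%C w Hth Ht Hw (Rle_trans _ _ _ HE H12)) as H.
  replace (t + 1 / 5 - w)%C with (t - s)%C in H by (unfold w; ring).
  apply (Rmult_le_reg_l (Cmod w ^ 4)); [exact Hw4|]. lra.
Qed.

(* After these, a polynomial inequality becomes linear in the monomials. *)
Ltac nonneg_powers x :=
  pose proof (pow_le x 2 ltac:(lra)); pose proof (pow_le x 3 ltac:(lra));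
  pose proof (pow_le x 4 ltac:(lra)); pose proof (pow_le x 5 ltac:(lra)).
Ltac weighted_squares x c :=
  nonneg_powers x;
  assert (0 <= x * (x - c) ^ 2) by (apply Rmult_le_pos; [lra|apply pow2_ge_0]);
  assert (0 <= x ^ 2 * (x - c) ^ 2) by (apply Rmult_le_pos; apply pow2_ge_0);
  assert (0 <= x ^ 3 * (x - c) ^ 2) by (apply Rmult_le_pos; [apply pow_le; lra|apply pow2_ge_0]);
  pose proof (pow2_ge_0 (x - c)).

(** The quotient of the two sides peaks near 0.3, so the auxiliary squares are centred there;
    likewise near 0.255 in [middle_poly], where only about three percent is to spare. *)
Lemma contraction_poly x : 0 <= x ->
  x * qbound x <= 0.26 * (3.738 * (1 + 0.707 * x)) * nlow x ^ 2.
Proof.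
  intros Hx. unfold qbound, nlow. weighted_squares x 0.3. lra.
Qed.

Lemma middle_poly x : 0 <= x ->
  x * qbound x <= 0.117 * (2.83 * (2.38 + 3.38 * x)) * nlow x ^ 2.
Proof.
  intros Hx. unfold qbound, nlow. weighted_squares x 0.25. weighted_squares x 0.26. lra.
Qed.

Lemma middle_poly_improved x : 0.6 <= x ->
  x * qbound x <= 0.082 * (2.83 * (2.38 + 3.38 * x)) * nlow x ^ 2.
Proof.
  intros Hx. unfold qbound, nlow. assert (Hu : 0 <= x - 0.6) by lra.
  set (u := x - 0.6) in *. replace x with (u + 0.6) by (unfold u; ring).
  nonneg_powers u. lra.
Qed.

Lemma small_poly x : 0 <= x <= 0.045 -> 0.0185 * qbound x <= 0.117 * nlow x ^ 2.
Proof. intros Hx. unfold qbound, nlow. nra. Qed.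

Lemma large_poly x : 5 <= x -> 1.29 * qbound x * x <= 0.3 * nlow x ^ 2.
Proof.
  intros Hx. unfold qbound, nlow. assert (Hu : 0 <= x - 5) by lra.
  set (u := x - 5) in *. replace x with (u + 5) by (unfold u; ring).
  nonneg_powers u. lra.
Qed.

(** This is the contraction of the relative error [|s - z| / |z|] with denominators cleared; up to
    the constant [|a/s|] that quotient is the error of [a/z]. *)
Lemma contraction th W m s z t : Rabs th <= PI -> sector th 1 1 W ->
  sector th (1 / 5) (1 / 4) s -> (s ^ 4 * (1 + s))%C = W ->
  sector th (1 / 5) (1 / 4) m -> (m ^ 4 * (1 + z))%C = W ->
  sector th 0 (1 / 5) (t + 1 / 5)%C -> ((t + 1 / 5) ^ 5)%C = radicand W m ->
  Cmod (s - z) <= 0.0257 * Cmod z ->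
  Cmod (s - t) * Cmod z <= 0.06 * (Cmod (s - z) * Cmod t).
Proof.
  intros Hth HW Hs Es Hm Em Ht Et HD.
  assert (HRe : 0.707 * Cmod s <= Re s).
  { pose proof (sector_Re_lower _ _ Hth Hs). pose proof sqrt2_bounds.
    pose proof (Cmod_ge_0 s). nra. }
  destruct (sector_Cmod _ _ _ _ Hs) as [Hs0 _]. destruct (sector_Cmod _ _ _ _ Hm) as [Hm0 _].
  set (sg := Cmod s) in *. set (mu := Cmod m) in *. set (D := Cmod (s - z)) in *.
  assert (HD0 : 0 <= D) by apply Cmod_ge_0.
  assert (Hz : Cmod z <= sg + D).
  { unfold sg, D. rewrite <- (Cmod_opp (s - z)). replace z with (s + - (s - z))%C at 1 by ring.
    apply Cmod_triangle. }
  assert (HD' : D <= 0.0264 * sg) by lra.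
  set (u := Cmod (1 + s)). set (v := Cmod (1 + z)).
  assert (Hu1 : 1 + 0.707 * sg <= u).
  { eapply Rle_trans; [|apply Re_le_Cmod]. rewrite re_plus. unfold Re at 1; simpl. lra. }
  assert (Husg : sg <= u).
  { pose proof (Cmod_one_plus_sqr s) as Q. fold u sg in Q.
    assert (0 <= u) by apply Cmod_ge_0. apply Rnot_lt_le. intros L. nra. }
  assert (Hv1 : v <= u + D).
  { unfold v, u, D. rewrite <- (Cmod_opp (s - z)).
    replace (1 + z)%C with ((1 + s) + - (s - z))%C by ring. apply Cmod_triangle. }
  assert (Hv2 : u <= v + D).
  { unfold v, u, D. replace (1 + s)%C with ((1 + z) + (s - z))%C by ring. apply Cmod_triangle. }
  assert (Emu : mu ^ 4 * v = sg ^ 4 * u).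
  { unfold mu, sg, v, u. rewrite <- !Cmod_pow, <- !Cmod_mult, Em, Es. reflexivity. }
  (* Since [D <= 0.0264 sg] and [sg <= u], the modulus [v] is between [0.9736 u] and [1.0264 u], and
     [mu / sg] is the fourth root of [u / v]. *)
  assert (Hmu1 : 0.9935 * sg <= mu).
  { apply Rnot_lt_le. intros L. assert (mu ^ 4 <= (0.9935 * sg) ^ 4) by (apply pow_incr; lra).
    assert (0 < sg ^ 4) by (apply pow_lt; lra).
    assert (mu ^ 4 * v <= (0.9935 * sg) ^ 4 * (1.0264 * u)).
    { apply Rmult_le_compat; try lra. apply pow_le; lra. }
    nra. }
  assert (Hmu2 : mu <= 1.01 * sg).
  { apply Rnot_lt_le. intros L. assert ((1.01 * sg) ^ 4 <= mu ^ 4) by (apply pow_incr; lra).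
    assert (0 < sg ^ 4) by (apply pow_lt; lra).
    assert ((1.01 * sg) ^ 4 * (0.9736 * u) <= mu ^ 4 * v).
    { apply Rmult_le_compat; try lra. }
    nra. }
  assert (H4 : 0.97 * (mu ^ 3 + mu ^ 2 * sg + mu * sg ^ 2 + sg ^ 3) * (Cmod (m - s) * v)
               <= sg ^ 4 * D).
  { apply (fourth_root_error th); auto. rewrite Em, Es. reflexivity. }
  set (d := Cmod (m - s)) in *.
  assert (Hd0 : 0 <= d) by apply Cmod_ge_0.
  (* The constant 3.738 is just below [3.84 * 0.9736]: the first factor comes from the sum of four
     moduli with [mu >= 0.9935 sg], the second from the lower bound on [v]. *)
  assert (Hd : d * (3.738 * (1 + 0.707 * sg)) <= sg * D).
  { assert (H3 : 3.84 * sg ^ 3 <= 0.97 * (mu ^ 3 + mu ^ 2 * sg + mu * sg ^ 2 + sg ^ 3)).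
    { assert ((0.9935 * sg) ^ 2 <= mu ^ 2) by (apply pow_incr; lra).
      assert ((0.9935 * sg) ^ 3 <= mu ^ 3) by (apply pow_incr; lra).
      assert (0 < sg ^ 2) by (apply pow_lt; lra).
      assert ((0.9935 * sg) ^ 2 * sg <= mu ^ 2 * sg) by (apply Rmult_le_compat_r; lra).
      assert (0.9935 * sg * sg ^ 2 <= mu * sg ^ 2) by (apply Rmult_le_compat_r; lra).
      assert (0 < sg ^ 3) by (apply pow_lt; lra). lra. }
    assert (0 < sg ^ 3) by (apply pow_lt; lra).
    apply (Rmult_le_reg_l (sg ^ 3)); [lra|].
    apply Rle_trans with (3.84 * sg ^ 3 * (d * v)).
    - assert (0.9736 * (1 + 0.707 * sg) <= v) by lra.
      assert (d * (0.9736 * (1 + 0.707 * sg)) <= d * v) by (apply Rmult_le_compat_l; lra).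
      assert (0 <= d * (1 + 0.707 * sg)) by (apply Rmult_le_pos; lra).
      nra.
    - eapply Rle_trans; [apply Rmult_le_compat_r; [|exact H3]|].
      + apply Rmult_le_pos; [lra|apply Cmod_ge_0].
      + lra. }
  assert (HP : d * qbound sg <= 0.26 * (D / sg) * sg * nlow sg ^ 2).
  { replace (0.26 * (D / sg) * sg) with (0.26 * D) by (field; lra).
    pose proof (contraction_poly sg (Rlt_le _ _ Hs0)) as Hc.
    assert (0 < 3.738 * (1 + 0.707 * sg)) by lra.
    pose proof (qbound_pos sg (Rlt_le _ _ Hs0)).
    apply (Rmult_le_reg_l (3.738 * (1 + 0.707 * sg))); [lra|].
    apply Rle_trans with (sg * D * qbound sg); [nra|].
    apply Rle_trans with (D * (sg * qbound sg)); [lra|].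
    apply Rle_trans with (D * (0.26 * (3.738 * (1 + 0.707 * sg)) * nlow sg ^ 2)); [|lra].
    apply Rmult_le_compat_l; lra. }
  assert (HDs : D / sg <= 0.0264).
  { apply (Rmult_le_reg_r sg); [lra|]. replace (D / sg * sg) with D by (field; lra). lra. }
  pose proof (root_error th W m s t (0.26 * (D / sg)) Hth HW Hs Es Ht Et Hmu2) as H.
  specialize (H ltac:(lra) HP). fold sg in H.
  replace (0.26 * (D / sg) * sg) with (0.26 * D) in H by (field; lra).
  rewrite <- (Cmod_opp (s - t)). replace (- (s - t))%C with (t - s)%C by ring.
  assert (Ht1 : sg <= Cmod t + Cmod (t - s)).
  { unfold sg. rewrite <- (Cmod_opp (t - s)). replace s with (t + - (t - s))%C at 1 by ring.
    apply Cmod_triangle. }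
  pose proof (Cmod_ge_0 (t - s)). pose proof (Cmod_ge_0 z).
  (* Here [0.26 / 4.7 < 0.0554] and [|z| <= 1.0264 sg]; the slack up to 0.06 pays for replacing [sg]
     by [|t|]. *)
  apply Rle_trans with (0.0554 * D * (1.0264 * sg)).
  - apply Rmult_le_compat; lra.
  - nra.
Qed.

(** * The first step *)

(** For [q = W / Z], of modulus at most 1 and angle at most [PI / 5], one has
    [|1 - q|^2 <= 1 - 1.6 |q| + |q|^2 <= 1]. *)
Lemma Cmod_minus_le_r th W Z : Rabs th <= PI -> sector th 1 1 W -> sector th (4 / 5) 1 Z ->
  Cmod W <= Cmod Z -> Cmod (W - Z) <= Cmod Z.
Proof.
  intros Hth HW HZ Hle.
  assert (HD : sector th 0 (1 / 5) (W / Z)%C).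
  { unfold Cdiv. eapply sector_weaken;
      [exact (sector_mult _ _ _ _ _ _ _ HW (sector_inv _ _ _ _ HZ))|lra|lra]. }
  pose proof (sector_neq_0 _ _ _ _ HZ) as HZ0.
  assert (HZ1 : 0 < Cmod Z) by (apply Cmod_gt_0; exact HZ0).
  assert (HD0 : 0 <= Cmod (W / Z) <= 1).
  { split; [apply Cmod_ge_0|]. rewrite Cmod_div by exact HZ0.
    apply (Rmult_le_reg_r (Cmod Z)); [exact HZ1|].
    replace (Cmod W / Cmod Z * Cmod Z) with (Cmod W) by (field; lra). lra. }
  assert (HRe : 0.8 * Cmod (W / Z) <= Re (W / Z)).
  { assert (C5 : 0.8 <= cos (1 / 5 * PI)).
    { replace (1 / 5 * PI) with (PI / 5) by field. apply cos_PI5. }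
    assert (L : leans (Cis (- (0 * th))) 0.8 (W / Z)%C)
      by (apply (sector_leans th 0 (1 / 5) 0 (1 / 5)); auto; lra).
    unfold leans in L.
    replace (- (0 * th)) with 0 in L by ring. rewrite Cis_0, Cmult_1_l in L. exact L. }
  replace (W - Z)%C with (Z * - (1 + - (W / Z)))%C by (field; exact HZ0).
  rewrite Cmod_mult, Cmod_opp.
  assert (Cmod (1 + - (W / Z)) <= 1); [|nra].
  pose proof (Cmod_one_plus_sqr (- (W / Z))%C) as Q. rewrite re_opp, Cmod_opp in Q.
  pose proof (Cmod_ge_0 (1 + - (W / Z))%C). nra.
Qed.

Definition init (th r : R) : C := (RtoC r * Cis (1 / 5 * th))%C.

Lemma init_sector th r : 0 < r -> sector th (1 / 5) (1 / 5) (init th r).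
Proof. intros Hr. exists r, (1 / 5). repeat split; try lra. Qed.

Lemma init_Cmod th r : 0 < r -> Cmod (init th r) = r.
Proof. intros. apply Cmod_polar. lra. Qed.

Lemma init_cos th : Rabs th <= PI -> 0.8 <= cos (1 / 5 * th).
Proof.
  intros Hth. eapply Rle_trans; [apply cos_PI5|]. pose proof PI_RGT_0. pose proof (Rabs_pos th).
  apply cos_le_cos_abs; rewrite (Rabs_pos_eq (PI / 5)) by lra; [|lra].
  rewrite Rabs_mult, (Rabs_pos_eq (1 / 5)); lra.
Qed.

Lemma init_one_plus_sqr th r : 0 < r ->
  Cmod (1 + init th r) ^ 2 = 1 + 2 * (r * cos (1 / 5 * th)) + r ^ 2.
Proof.
  intros Hr. rewrite Cmod_one_plus_sqr, init_Cmod by exact Hr.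
  unfold init. rewrite re_scal_l. reflexivity.
Qed.

(* The constant [alpha] is tuned to this: [|1 + s|^2 >= (2 + sqrt 2) |s|]. *)
Lemma Cmod_root_le_init th r s : Rabs th <= PI -> 0 < r ->
  sector th (1 / 5) (1 / 4) s ->
  (2 + sqrt 2) * r ^ 9 = Cmod s ^ 8 * Cmod (1 + s) ^ 2 -> Cmod s <= r.
Proof.
  intros Hth Hr Hs E.
  pose proof (Cmod_one_plus_lower _ _ Hth Hs) as H.
  destruct (sector_Cmod _ _ _ _ Hs) as [Hs0 _]. pose proof sqrt2_bounds.
  assert (H2 : (2 + sqrt 2) * Cmod s <= Cmod (1 + s) ^ 2)
    by (pose proof (pow2_ge_0 (1 - Cmod s)); lra).
  apply Rnot_lt_le. intros L.
  assert (H9 : r ^ 8 <= Cmod s ^ 8) by (apply pow_incr; lra).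
  assert (H8 : 0 < Cmod s ^ 8) by (apply pow_lt; lra).
  assert (Cmod s ^ 8 * ((2 + sqrt 2) * Cmod s) <= Cmod s ^ 8 * Cmod (1 + s) ^ 2)
    by (apply Rmult_le_compat_l; lra).
  assert (r * r ^ 8 < Cmod s * Cmod s ^ 8).
  { apply Rle_lt_trans with (r * Cmod s ^ 8);
      [apply Rmult_le_compat_l|apply Rmult_lt_compat_r]; lra. }
  assert ((2 + sqrt 2) * (r * r ^ 8) < (2 + sqrt 2) * (Cmod s * Cmod s ^ 8))
    by (apply Rmult_lt_compat_l; lra).
  lra.
Qed.

(** Equality would give [(2 + sqrt 2) r = 1 + 2 r cos (th / 5) + r^2], whose right side is at least
    [3.6 r]. This starts the proof that no iterate is exact. *)
Lemma init_neq_root th r s : Rabs th <= PI -> 0 < r ->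
  (2 + sqrt 2) * r ^ 9 = Cmod s ^ 8 * Cmod (1 + s) ^ 2 -> s <> init th r.
Proof.
  intros Hth Hr E ->. rewrite init_one_plus_sqr, init_Cmod in E by exact Hr.
  pose proof (init_cos th Hth). pose proof sqrt2_bounds.
  assert (H8 : 0 < r ^ 8) by (apply pow_lt; exact Hr).
  replace (r ^ 9) with (r ^ 8 * r) in E by ring.
  assert (E' : (2 + sqrt 2) * r = 1 + 2 * (r * cos (1 / 5 * th)) + r ^ 2).
  { apply (Rmult_eq_reg_l (r ^ 8)); lra. }
  pose proof (pow2_ge_0 (1 - r)). nra.
Qed.

(** The root [s] is no longer than the initial value and its angle is at least as large in absolute
    value, so its real part is no larger. Consequently [|m| <= |s|] in the first step. *)
Lemma one_plus_root_le_init th r s : Rabs th <= PI -> 0 < r ->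
  sector th (1 / 5) (1 / 4) s -> Cmod s <= r -> Cmod (1 + s) <= Cmod (1 + init th r).
Proof.
  intros Hth Hr Hs Hle.
  enough (Cmod (1 + s) ^ 2 <= Cmod (1 + init th r) ^ 2).
  { pose proof (Cmod_ge_0 (1 + s)). pose proof (Cmod_ge_0 (1 + init th r)). nra. }
  rewrite init_one_plus_sqr, Cmod_one_plus_sqr by exact Hr.
  apply sector_Cmod in Hs. destruct Hs as (Hs0 & c & Hc & E).
  assert (HRe : Re s = Cmod s * cos (c * th)) by (rewrite E at 1; apply re_scal_l).
  assert (cos (c * th) <= cos (1 / 5 * th)).
  { pose proof PI_RGT_0. pose proof (Rabs_pos th).
    apply cos_le_cos_abs; rewrite !Rabs_mult, ?(Rabs_pos_eq c), ?(Rabs_pos_eq (1 / 5)) by lra; nra. }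
  pose proof (init_cos th Hth). rewrite HRe.
  assert (Cmod s * cos (c * th) <= r * cos (1 / 5 * th)).
  { apply Rle_trans with (Cmod s * cos (1 / 5 * th));
      [apply Rmult_le_compat_l|apply Rmult_le_compat_r]; lra. }
  assert (Cmod s ^ 2 <= r ^ 2) by (apply pow_incr; lra). lra.
Qed.

(** With [z] the initial value, [W - z^4 (1 + z) = S (s - z)], where the nine monomials of [S] lie
    in the sector [[3/5, 1]]; axis 4/5 and half-width 1/5 give the factor [0.8 <= cos (PI / 5)]. *)
Lemma init_error th W r s : Rabs th <= PI -> sector th 1 1 W ->
  sector th (1 / 5) (1 / 4) s -> (s ^ 4 * (1 + s))%C = W -> 0 < r ->
  (2 + sqrt 2) * r ^ 9 = Cmod W ^ 2 -> sector th 0 (1 / 5) (1 + init th r)%C ->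
  0.8 * (Cmod s ^ 3 + Cmod s ^ 2 * r + Cmod s * r ^ 2 + r ^ 3 +
    (Cmod s ^ 4 + Cmod s ^ 3 * r + Cmod s ^ 2 * r ^ 2 + Cmod s * r ^ 3 + r ^ 4))
  * Cmod (s - init th r) <= r ^ 4 * Cmod (1 + init th r).
Proof.
  intros Hth HW Hs Es Hr Er H1z.
  pose proof (init_sector th r Hr) as Hz. pose proof (init_Cmod th r Hr) as Mz.
  set (z := init th r) in *.
  assert (HZ : sector th (4 / 5) 1 (z ^ 4 * (1 + z))%C).
  { pose proof (sector_pow _ _ _ _ 4 Hz) as H4. simpl INR in H4.
    eapply sector_weaken; [exact (sector_mult _ _ _ _ _ _ _ H4 H1z)|lra|lra]. }
  assert (Hle : Cmod W <= Cmod (z ^ 4 * (1 + z))).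
  { rewrite Cmod_mult, Cmod_pow, Mz.
    assert (HQ : Cmod W ^ 2 <= (r ^ 4 * Cmod (1 + z)) ^ 2).
    { rewrite <- Er. replace ((r ^ 4 * Cmod (1 + z)) ^ 2) with (r ^ 8 * Cmod (1 + z) ^ 2) by ring.
      unfold z. rewrite init_one_plus_sqr by exact Hr.
      pose proof (init_cos th Hth). pose proof sqrt2_bounds.
      replace ((2 + sqrt 2) * r ^ 9) with (r ^ 8 * ((2 + sqrt 2) * r)) by ring.
      apply Rmult_le_compat_l; [apply pow_le; lra|].
      pose proof (pow2_ge_0 (1 - r)). nra. }
    pose proof (Cmod_ge_0 W). assert (0 <= r ^ 4 * Cmod (1 + z)); [|nra].
    apply Rmult_le_pos; [apply pow_le; lra|apply Cmod_ge_0]. }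
  pose proof (Cmod_minus_le_r th W _ Hth HW HZ Hle) as HM.
  set (S := (s ^ 3 + s ^ 2 * z + s * z ^ 2 + z ^ 3 +
    (s ^ 4 + s ^ 3 * z + s ^ 2 * z ^ 2 + s * z ^ 3 + z ^ 4))%C).
  assert (F : (W - z ^ 4 * (1 + z) = S * (s - z))%C) by (rewrite <- Es; unfold S; ring).
  rewrite F, !Cmod_mult, Cmod_pow, Mz in HM.
  eapply Rle_trans; [|exact HM]. apply Rmult_le_compat_r; [apply Cmod_ge_0|].
  eapply Rle_trans; [|apply (Re_Cis_le_Cmod (- (4 / 5 * th)))].
  assert (C5 : 0.8 <= cos (1 / 5 * PI)).
  { replace (1 / 5 * PI) with (PI / 5) by field. apply cos_PI5. }
  assert (L : forall u, sector th (3 / 5) 1 u -> 0.8 * Cmod u <= Re (Cis (- (4 / 5 * th)) * u)%C).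
  { intros u Hu. apply (sector_leans th (3 / 5) 1 (4 / 5) (1 / 5)); auto; lra. }
  pose proof (sector_pow _ _ _ _ 2 Hs). pose proof (sector_pow _ _ _ _ 3 Hs).
  pose proof (sector_pow _ _ _ _ 4 Hs). pose proof (sector_pow _ _ _ _ 2 Hz).
  pose proof (sector_pow _ _ _ _ 3 Hz). pose proof (sector_pow _ _ _ _ 4 Hz).
  simpl INR in *. rewrite <- Mz, <- !Cmod_pow, <- !Cmod_mult. unfold S.
  repeat apply (Re_mult_plus_lower _ 0.8); apply L;
    first [eapply sector_weaken; [eassumption|lra|lra]
          |eapply sector_weaken; [eapply sector_mult; eassumption|lra|lra]].
Qed.

Lemma fourth_root_le (mu sg u v : R) : 0 < mu -> 0 < sg -> 0 <= u <= v -> 0 < v ->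
  mu ^ 4 * v = sg ^ 4 * u -> mu <= sg.
Proof.
  intros Hmu Hsg Hu Hv E. apply Rnot_lt_le. intros L.
  assert (H4 : 0 < sg ^ 4) by (apply pow_lt; lra).
  assert (sg ^ 3 <= mu ^ 3) by (apply pow_incr; lra).
  assert (sg ^ 4 < mu ^ 4).
  { apply Rle_lt_trans with (sg * mu ^ 3).
    - replace (sg ^ 4) with (sg * sg ^ 3) by ring. apply Rmult_le_compat_l; lra.
    - replace (mu ^ 4) with (mu * mu ^ 3) by ring. apply Rmult_lt_compat_r; [apply pow_lt|]; lra. }
  nra.
Qed.

(* With [r = |z_0|], [sg = |s|], [mu = |m|], [d = |m - s|], [e = |s - z_0|],
   [u = |1 + s|], [v = |1 + z_0|]. *)
Lemma first_step_real_bound (r sg mu d e u v : R) :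
  0 < mu <= sg -> 0 < sg <= r -> 0 <= d -> 0 <= e -> 0 < u <= v -> v <= 1 + r ->
  1 + 1.414 * sg + sg ^ 2 <= u ^ 2 -> u <= 1 + sg -> 1 <= u ->
  (2 + sqrt 2) * r ^ 9 = sg ^ 8 * u ^ 2 ->
  mu ^ 4 * v = sg ^ 4 * u ->
  0.97 * (mu ^ 3 + mu ^ 2 * sg + mu * sg ^ 2 + sg ^ 3) * (d * v) <= sg ^ 4 * e ->
  0.8 * (sg ^ 3 + sg ^ 2 * r + sg * r ^ 2 + r ^ 3 +
    (sg ^ 4 + sg ^ 3 * r + sg ^ 2 * r ^ 2 + sg * r ^ 3 + r ^ 4)) * e <= r ^ 4 * v ->
  exists p, 0 <= p <= 0.117 /\ (1 + sg) * p ^ 4 <= 0.00031 /\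
    d * qbound sg <= p * sg * nlow sg ^ 2.
Proof.
  intros Hmu Hsg Hd He Hu Hv Hu2 Hu1 Hu0 Er Emu H4 H8.
  pose proof sqrt2_bounds as Q2.
  assert (Hn : 0 < nlow sg) by (unfold nlow; nra).
  assert (Hn2 : 0 < nlow sg ^ 2) by (apply pow_lt; exact Hn).
  pose proof (qbound_pos sg ltac:(lra)) as Hq.
  assert (Pm : forall k, 0 < mu ^ k) by (intros; apply pow_lt; lra).
  assert (Ps : forall k, 0 < sg ^ k) by (intros; apply pow_lt; lra).
  assert (Pr : forall k, 0 < r ^ k) by (intros; apply pow_lt; lra).
  assert (Pp : forall k l, 0 < sg ^ k * r ^ l) by (intros; apply Rmult_lt_0_compat; auto).
  assert (Pdv : 0 <= d * v) by (apply Rmult_le_pos; lra).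
  (* A lower bound [k] on [mu / sg] and an upper bound [x] on [e / v] give one on [d / sg]. *)
  assert (key : forall k x, 0 <= k -> k * sg <= mu -> 0 <= x -> e <= x * v ->
     0.97 * (1 + k + k ^ 2 + k ^ 3) * d <= sg * x).
  { intros k x Hk Hks Hx Hex.
    assert ((k * sg) ^ 2 <= mu ^ 2) by (apply pow_incr; split; [apply Rmult_le_pos|]; lra).
    assert ((k * sg) ^ 3 <= mu ^ 3) by (apply pow_incr; split; [apply Rmult_le_pos|]; lra).
    assert ((k * sg) ^ 2 * sg <= mu ^ 2 * sg) by (apply Rmult_le_compat_r; lra).
    assert (k * sg * sg ^ 2 <= mu * sg ^ 2) by (apply Rmult_le_compat_r; [pose proof (Ps 2%nat)|]; lra).
    apply (Rmult_le_reg_l (sg ^ 3 * v)); [apply Rmult_lt_0_compat; [auto|lra]|].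
    apply Rle_trans with (0.97 * (mu ^ 3 + mu ^ 2 * sg + mu * sg ^ 2 + sg ^ 3) * (d * v)).
    - replace (sg ^ 3 * v * (0.97 * (1 + k + k ^ 2 + k ^ 3) * d))
        with (0.97 * (sg ^ 3 + k * sg * sg ^ 2 + (k * sg) ^ 2 * sg + (k * sg) ^ 3) * (d * v)) by ring.
      apply Rmult_le_compat_r; lra.
    - eapply Rle_trans; [exact H4|].
      replace (sg ^ 3 * v * (sg * x)) with (sg ^ 4 * (x * v)) by ring.
      apply Rmult_le_compat_l; [left; auto|exact Hex]. }
  (* The hypothesis on [r] amounts to [(r / sg)^9 = u^2 / ((2 + sqrt 2) sg)], which blows up as [sg]
     tends to 0 or to infinity; [r] is comparable to [sg] only in the middle range. *)
  destruct (Rle_lt_dec sg 0.045) as [L1|L1]; [|destruct (Rle_lt_dec sg 5) as [L2|L2]].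
  - assert (Hr : r <= 0.0561).
    { apply Rnot_lt_le. intros L.
      assert (sg ^ 8 <= 0.045 ^ 8) by (apply pow_incr; lra).
      assert (0.0561 ^ 9 <= r ^ 9) by (apply pow_incr; lra).
      assert (u ^ 2 <= 1.045 ^ 2) by (apply pow_incr; lra).
      assert (sg ^ 8 * u ^ 2 <= 0.045 ^ 8 * 1.045 ^ 2)
        by (apply Rmult_le_compat; try lra; [left; auto|apply pow2_ge_0]).
      assert (3.4142 * 0.0561 ^ 9 <= (2 + sqrt 2) * r ^ 9) by (apply Rmult_le_compat; lra).
      lra. }
    assert (Hk : 0.985 * sg <= mu).
    { apply Rnot_lt_le. intros L.
      assert (mu ^ 4 <= (0.985 * sg) ^ 4) by (apply pow_incr; lra).
      assert (mu ^ 4 * v <= (0.985 * sg) ^ 4 * 1.0561)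
        by (apply Rmult_le_compat; try lra; left; auto).
      assert (sg ^ 4 * 1 <= sg ^ 4 * u) by (apply Rmult_le_compat_l; [left; auto|lra]).
      pose proof (Ps 4%nat). lra. }
    (* Of the nine terms only [r^3] is kept. *)
    assert (He1 : e <= 1.25 * r * v).
    { apply (Rmult_le_reg_l (0.8 * r ^ 3)); [pose proof (Pr 3%nat); lra|].
      replace (0.8 * r ^ 3 * (1.25 * r * v)) with (r ^ 4 * v) by lra.
      eapply Rle_trans; [|exact H8]. apply Rmult_le_compat_r; [exact He|].
      pose proof (Pp 3 0)%nat. pose proof (Pp 2 1)%nat. pose proof (Pp 1 2)%nat.
      pose proof (Pp 4 0)%nat. pose proof (Pp 3 1)%nat. pose proof (Pp 2 2)%nat.
      pose proof (Pp 1 3)%nat. pose proof (Pr 4)%nat. lra. }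
    pose proof (key 0.985 (1.25 * r) ltac:(lra) Hk ltac:(lra) He1) as K.
    exists 0.117. split; [lra|]. split; [lra|].
    assert (sg * (1.25 * r) <= sg * (1.25 * 0.0561)) by (apply Rmult_le_compat_l; lra).
    assert (Hd' : d <= 0.0185 * sg) by lra.
    apply Rle_trans with (0.0185 * sg * qbound sg); [apply Rmult_le_compat_r; lra|].
    pose proof (small_poly sg ltac:(lra)) as Hs.
    apply Rle_trans with (sg * (0.0185 * qbound sg)); [lra|].
    replace (0.117 * sg * nlow sg ^ 2) with (sg * (0.117 * nlow sg ^ 2)) by ring.
    apply Rmult_le_compat_l; lra.
  (* The bound holds because [3.4142 * 1.245^9 > 24.5] and [(1 + x)^2 < 24.5 x] for
     [0.045 < x <= 5]. *)
  - assert (Hr : r <= 1.245 * sg).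
    { apply Rnot_lt_le. intros L.
      assert ((1.245 * sg) ^ 9 <= r ^ 9) by (apply pow_incr; lra).
      assert (u ^ 2 <= (1 + sg) ^ 2) by (apply pow_incr; lra).
      assert (sg ^ 8 * u ^ 2 <= sg ^ 8 * (1 + sg) ^ 2) by (apply Rmult_le_compat_l; [left; auto|lra]).
      assert (3.4142 * (1.245 * sg) ^ 9 <= (2 + sqrt 2) * r ^ 9)
        by (apply Rmult_le_compat; try lra; apply pow_le; lra).
      assert (sg ^ 8 * (24.5 * sg) < sg ^ 8 * (24.5 * sg)); [|lra].
      apply Rle_lt_trans with (sg ^ 8 * (1 + sg) ^ 2); [pose proof (Ps 9%nat); lra|].
      apply Rmult_lt_compat_l; [auto|nra]. }
    assert (Hk : 0.94 * sg <= mu).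
    { apply Rnot_lt_le. intros L.
      assert (mu ^ 8 <= (0.94 * sg) ^ 8) by (apply pow_incr; lra).
      assert (v ^ 2 <= (1 + 1.245 * sg) ^ 2) by (apply pow_incr; lra).
      assert (E8 : mu ^ 8 * v ^ 2 = sg ^ 8 * u ^ 2).
      { replace (mu ^ 8 * v ^ 2) with ((mu ^ 4 * v) ^ 2) by ring. rewrite Emu. ring. }
      assert (mu ^ 8 * v ^ 2 <= (0.94 * sg) ^ 8 * (1 + 1.245 * sg) ^ 2)
        by (apply Rmult_le_compat; try lra; [left; auto|apply pow2_ge_0]).
      assert (sg ^ 8 * (1 + 1.414 * sg + sg ^ 2) <= sg ^ 8 * u ^ 2)
        by (apply Rmult_le_compat_l; [left; auto|lra]).
      assert (sg ^ 8 * (0.6096 * (1 + 1.245 * sg) ^ 2) < sg ^ 8 * (1 + 1.414 * sg + sg ^ 2))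
        by (apply Rmult_lt_compat_l; [auto|nra]).
      assert ((0.94 * sg) ^ 8 * (1 + 1.245 * sg) ^ 2 <= sg ^ 8 * (0.6096 * (1 + 1.245 * sg) ^ 2)); [|lra].
      replace ((0.94 * sg) ^ 8 * (1 + 1.245 * sg) ^ 2)
        with (sg ^ 8 * (0.94 ^ 8 * (1 + 1.245 * sg) ^ 2)) by ring.
      apply Rmult_le_compat_l; [left; auto|]. apply Rmult_le_compat_r; [apply pow2_ge_0|lra]. }
    assert (He1 : e <= sg / (0.8 * (2.38 + 3.38 * sg)) * v).
    { assert (G : r ^ 4 * (2.38 + 3.38 * sg) <= sg * (sg ^ 3 + sg ^ 2 * r + sg * r ^ 2 + r ^ 3 +
        (sg ^ 4 + sg ^ 3 * r + sg ^ 2 * r ^ 2 + sg * r ^ 3 + r ^ 4))).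
      (* With [y = sg / r >= 1 / 1.245], the sum [y + y^2 + y^3 + y^4] exceeds 2.38. The five terms
         of degree 4 contribute one more [r^4], hence 3.38. *)
      { assert (G4 : 2.38 * r ^ 4 <= sg * (sg ^ 3 + sg ^ 2 * r + sg * r ^ 2 + r ^ 3)).
        { set (w := r - sg). assert (Hw : 0 <= w <= 0.245 * sg) by (unfold w; lra).
          replace r with (sg + w) by (unfold w; ring).
          assert (w ^ 2 <= (0.245 * sg) ^ 2) by (apply pow_incr; exact Hw).
          assert (w ^ 3 <= (0.245 * sg) ^ 3) by (apply pow_incr; exact Hw).
          assert (w ^ 4 <= (0.245 * sg) ^ 4) by (apply pow_incr; exact Hw).
          assert (sg ^ 3 * w <= sg ^ 3 * (0.245 * sg)) by (apply Rmult_le_compat_l; [left; auto|lra]).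
          assert (sg ^ 2 * w ^ 2 <= sg ^ 2 * (0.245 * sg) ^ 2) by (apply Rmult_le_compat_l; [left; auto|lra]).
          assert (sg * w ^ 3 <= sg * (0.245 * sg) ^ 3) by (apply Rmult_le_compat_l; lra).
          pose proof (Ps 4)%nat. lra. }
        nra. }
      apply (Rmult_le_reg_l (0.8 * (2.38 + 3.38 * sg) * r ^ 4)); [apply Rmult_lt_0_compat; [nra|auto]|].
      replace (0.8 * (2.38 + 3.38 * sg) * r ^ 4 * (sg / (0.8 * (2.38 + 3.38 * sg)) * v))
        with (sg * (r ^ 4 * v)) by (field; nra).
      eapply Rle_trans; [|apply Rmult_le_compat_l; [|exact H8]; lra].
      nra. }
    set (x := sg / (0.8 * (2.38 + 3.38 * sg))) in *.
    assert (Hx : x * (0.8 * (2.38 + 3.38 * sg)) = sg) by (unfold x; field; nra).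
    assert (Hx0 : 0 <= x) by (unfold x; apply Rmult_le_pos; [lra|left; apply Rinv_0_lt_compat; nra]).
    pose proof (key 0.94 x ltac:(lra) Hk Hx0 He1) as K.
    (* Here [2.83 = 0.8 * 3.5375], and 3.5375 is below [0.97 (1 + 0.94 + 0.94^2 + 0.94^3)]. *)
    set (T := 2.83 * (2.38 + 3.38 * sg)). assert (HT : 0 < T) by (unfold T; lra).
    assert (Hd' : d * T <= sg ^ 2).
    { assert (K1 : 3.5375 * d <= sg * x) by lra.
      assert (K2 : 3.5375 * d * (0.8 * (2.38 + 3.38 * sg)) <= sg * x * (0.8 * (2.38 + 3.38 * sg)))
        by (apply Rmult_le_compat_r; lra).
      unfold T. replace (sg ^ 2) with (sg * (x * (0.8 * (2.38 + 3.38 * sg)))) by (rewrite Hx; ring).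
      lra. }
    assert (finish : forall p, sg * qbound sg <= p * T * nlow sg ^ 2 ->
      d * qbound sg <= p * sg * nlow sg ^ 2).
    { intros p Hp. apply (Rmult_le_reg_l T); [exact HT|].
      apply Rle_trans with (sg ^ 2 * qbound sg).
      - replace (T * (d * qbound sg)) with (d * T * qbound sg) by ring.
        apply Rmult_le_compat_r; lra.
      - replace (sg ^ 2 * qbound sg) with (sg * (sg * qbound sg)) by ring.
        replace (T * (p * sg * nlow sg ^ 2)) with (sg * (p * T * nlow sg ^ 2)) by ring.
        apply Rmult_le_compat_l; lra. }
    (* The value 0.117 meets [(1 + sg) p^4 <= 0.00031] only up to about [sg = 0.65]; beyond 0.6 the
       smaller 0.082 is available and serves up to 5. *)
    destruct (Rle_lt_dec sg 0.6) as [L3|L3].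
    + exists 0.117. split; [lra|]. split; [lra|]. apply finish. apply middle_poly. lra.
    + exists 0.082. split; [lra|]. split; [lra|]. apply finish. apply middle_poly_improved. lra.
  - assert (He1 : e <= 1.25 * v).
    { apply (Rmult_le_reg_l (0.8 * r ^ 4)); [pose proof (Pr 4%nat); lra|].
      replace (0.8 * r ^ 4 * (1.25 * v)) with (r ^ 4 * v) by lra.
      eapply Rle_trans; [|exact H8]. apply Rmult_le_compat_r; [exact He|].
      pose proof (Pp 3 0)%nat. pose proof (Pp 2 1)%nat. pose proof (Pp 1 2)%nat.
      pose proof (Pp 4 0)%nat. pose proof (Pp 3 1)%nat. pose proof (Pp 2 2)%nat.
      pose proof (Pp 1 3)%nat. pose proof (Pr 3)%nat. lra. }
    (* No lower bound on [mu / sg] is spent here: the crude [d <= 1.29 sg] suffices, and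
       [p = 0.3 / sg] decays fast enough for the fourth-power condition. *)
    pose proof (key 0 1.25 ltac:(lra) ltac:(lra) ltac:(lra) He1) as K.
    set (p := 0.3 / sg). assert (Hp : p * sg = 0.3) by (unfold p; field; lra).
    assert (Hp0 : 0 < p <= 0.06).
    { split; [unfold p; apply Rdiv_lt_0_compat; lra|]. apply (Rmult_le_reg_r sg); lra. }
    exists p. split; [lra|]. split.
    + assert (p ^ 3 <= 0.06 ^ 3) by (apply pow_incr; lra).
      replace ((1 + sg) * p ^ 4) with ((p + p * sg) * p ^ 3) by ring. rewrite Hp.
      apply Rle_trans with (0.36 * 0.06 ^ 3); [apply Rmult_le_compat; try lra; apply pow_le|]; lra.
    + rewrite Hp. apply Rle_trans with (1.29 * sg * qbound sg).
      * apply Rmult_le_compat_r; lra.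
      * pose proof (large_poly sg ltac:(lra)). lra.
Qed.

Lemma first_step_error th W r s m t : Rabs th <= PI -> sector th 1 1 W ->
  sector th (1 / 5) (1 / 4) s -> (s ^ 4 * (1 + s))%C = W ->
  0 < r -> (2 + sqrt 2) * r ^ 9 = Cmod W ^ 2 -> sector th 0 (1 / 5) (1 + init th r)%C ->
  sector th (1 / 5) (1 / 4) m -> (m ^ 4 * (1 + init th r))%C = W ->
  sector th 0 (1 / 5) (t + 1 / 5)%C -> ((t + 1 / 5) ^ 5)%C = radicand W m ->
  exists p, 0 <= p <= 0.117 /\ (1 + Cmod s) * p ^ 4 <= 0.00031 /\
    4.7 * Cmod (t - s) <= p * Cmod s.
Proof.
  intros Hth HW Hs Es Hr Er H1z Hm Em Ht Et.
  destruct (sector_Cmod _ _ _ _ Hs) as [Hs0 _]. destruct (sector_Cmod _ _ _ _ Hm) as [Hm0 _].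
  destruct (sector_Cmod _ _ _ _ H1z) as [Hv0 _].
  assert (Er' : (2 + sqrt 2) * r ^ 9 = Cmod s ^ 8 * Cmod (1 + s) ^ 2).
  { rewrite Er, <- Es, Cmod_mult, Cmod_pow. ring. }
  pose proof (Cmod_root_le_init th r s Hth Hr Hs Er') as Hsr.
  pose proof (one_plus_root_le_init th r s Hth Hr Hs Hsr) as Huv.
  assert (Emu : Cmod m ^ 4 * Cmod (1 + init th r) = Cmod s ^ 4 * Cmod (1 + s))
    by (rewrite <- !Cmod_pow, <- !Cmod_mult, Em, Es; reflexivity).
  pose proof (Cmod_ge_0 (1 + s)) as Hu0.
  pose proof (fourth_root_le _ _ _ _ Hm0 Hs0 (conj Hu0 Huv) Hv0 Emu) as Hms.
  pose proof (Cmod_one_plus_lower _ _ Hth Hs) as Hu2. pose proof sqrt2_bounds.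
  assert (Hu1 : 1 <= Cmod (1 + s)) by nra.
  destruct (first_step_real_bound r (Cmod s) (Cmod m) (Cmod (m - s)) (Cmod (s - init th r))
    (Cmod (1 + s)) (Cmod (1 + init th r))) as (p & Hp & Hp4 & HP); auto using Cmod_ge_0; try lra.
  - eapply Rle_trans; [apply Cmod_triangle|]. rewrite Cmod_1, init_Cmod by exact Hr. lra.
  - nra.
  - eapply Rle_trans; [apply Cmod_triangle|]. rewrite Cmod_1. lra.
  - apply (fourth_root_error th); auto. rewrite Em, Es. reflexivity.
  - apply (init_error th W); auto.
  - exists p. split; [exact Hp|]. split; [exact Hp4|].
    apply (root_error th W m); auto; lra.
Qed.

(** * Convergence *)

(** If [t = s], then [m - s] times the cofactor in [radicand_minus] vanishes. The cofactor lies in a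
    sector, so it is nonzero; hence [m = s], and then [z = s]. *)
Lemma iterate_neq_root th W s m z t : Rabs th <= PI ->
  sector th (1 / 5) (1 / 4) s -> (s ^ 4 * (1 + s))%C = W ->
  sector th (1 / 5) (1 / 4) m -> (m ^ 4 * (1 + z))%C = W ->
  ((t + 1 / 5) ^ 5)%C = radicand W m -> s <> z -> s <> t.
Proof.
  intros Hth Hs Es Hm Em Et Hz F. subst t. apply Hz.
  rewrite <- (radicand_fixed W s Es) in Et.
  pose proof (radicand_minus W m s) as Q. rewrite <- Et in Q.
  assert (HQ : sector th 0 (1 / 2)
    (2 / 5 * (m ^ 2 + m * s + s ^ 2) + 2 / 25 * (m + s) + 1 / 125)%C).
  { rewrite !Cdiv_RtoC by lra.
    pose proof (sector_pow _ _ _ _ 2 Hs) as Hs2. pose proof (sector_pow _ _ _ _ 2 Hm) as Hm2.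
    pose proof (sector_mult _ _ _ _ _ _ _ Hm Hs) as Hms. simpl INR in *.
    repeat (apply sector_plus_in || (apply sector_scal; [lra|])); try exact Hth; try lra;
      try (eapply sector_weaken; [eassumption|lra|lra]).
    apply sector_weaken with 0 0; [apply sector_real|..]; lra. }
  apply sector_neq_0 in HQ.
  assert (E : m = s).
  { set (q := (2 / 5 * (m ^ 2 + m * s + s ^ 2) + 2 / 25 * (m + s) + 1 / 125)%C) in *.
    assert (D : (m - s)%C = 0).
    { transitivity ((m - s) * q / q)%C; [field; exact HQ|]. rewrite <- Q. field. exact HQ. }
    transitivity ((m - s) + s)%C; [ring|]. rewrite D. ring. }
  subst m. rewrite <- Es in Em. apply sector_neq_0 in Hs. apply (Cpow_nz _ 4) in Hs.
  transitivity (s ^ 4 * (1 + s) / s ^ 4 - 1)%C; [field|rewrite <- Em; field].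
  - intros F. apply Hs. rewrite F. ring.
  - intros F. apply Hs. rewrite F. ring.
Qed.

Lemma Cmod_quotient_minus (a s t : C) : s <> 0 -> t <> 0 ->
  Cmod (a / t - a / s) = Cmod a / Cmod s * (Cmod (s - t) / Cmod t).
Proof.
  intros Hs Ht.
  replace (a / t - a / s)%C with ((a / s) * ((s - t) / t))%C by (field; auto).
  rewrite Cmod_mult, !Cmod_div by assumption. reflexivity.
Qed.

Theorem lemma7 (a : C) (ha : a <> RtoC 0) :
  exists zstar : C,
    (zstar ^ 5 + zstar ^ 4)%C = (- (a ^ 4))%C /\
    let xstar := (a / zstar)%C in
    (xstar ^ 5 + xstar + a)%C = RtoC 0 /\
    Cmod (xseq a 1 - xstar) < 0.0290 /\
    Cmod (xseq a 1 / xstar - 1) < 0.0257 /\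
    (forall k : nat, (1 <= k)%nat ->
       Cmod (xseq a (S k) - xstar) < 1 / 14.68 * Cmod (xseq a k - xstar) /\
       Cmod (xseq a (S k) - xstar) < 0.0290 / 14.68 ^ k).
Proof.
  destruct (zseq_0_polar a ha) as (r & Hr & Ez & Er).
  set (W := (2 * lam a)%C) in *. set (th := Carg W) in *. fold (init th r) in Ez.
  assert (EW : W = (- a ^ 4)%C) by (unfold W, lam; field).
  assert (HW0 : W <> 0).
  { rewrite EW. intros F. apply (Cpow_nz a 4 ha).
    replace (a ^ 4)%C with (- (- a ^ 4))%C by ring. rewrite F. ring. }
  destruct (Carg_polar W HW0) as [Hb EWp]. fold th in Hb, EWp.
  assert (HWm : 0 < Cmod W) by (apply Cmod_gt_0; exact HW0).
  assert (Hth : Rabs th <= PI) by (apply Rabs_le; lra).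
  assert (HW : sector th 1 1 W).
  { exists (Cmod W), 1. repeat split; try lra. rewrite Rmult_1_l. exact EWp. }
  destruct (quintic_root th (Cmod W)) as (s & Hs & Es); [lra|exact HWm|].
  rewrite <- EWp in Es.
  pose proof (sector_neq_0 _ _ _ _ Hs) as Hs0. destruct (sector_Cmod _ _ _ _ Hs) as [Hsm _].
  assert (H0 : sector th 0 (1 / 5) (1 + zseq a 0)%C).
  { rewrite Ez. apply sector_plus_in; [exact Hth|lra| |].
    - apply sector_weaken with 0 0; [apply sector_real|..]; lra.
    - eapply sector_weaken; [apply init_sector; exact Hr|lra|lra]. }
  pose proof (fun k => zseq_sector a th k Hb HW H0) as Hz.
  pose proof (fun k => iteration_step a th (zseq a k) Hb HW (Hz k)) as step.
  assert (Hne : forall k, s <> zseq a k).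
  { induction k as [|k IH].
    - rewrite Ez. apply (init_neq_root th r s Hth Hr).
      rewrite Er, <- Es, Cmod_mult, Cmod_pow. ring.
    - destruct (step k) as (Hm & Em & _ & Et & _). rewrite zseq_S.
      exact (iterate_neq_root _ _ _ _ _ _ Hth Hs Es Hm Em Et IH). }
  assert (first : exists p, 0 <= p <= 0.117 /\ (1 + Cmod s) * p ^ 4 <= 0.00031 /\
    4.7 * Cmod (zseq a 1 - s) <= p * Cmod s).
  { destruct (step O) as (Hm & Em & Ht & Et & _). rewrite zseq_S.
    rewrite Ez in Em, H0.
    apply (first_step_error th W r s (m_of a (zseq a 0))); auto. rewrite Ez. exact Em. }
  destruct first as (p & Hp & Hp4 & HD).
  set (t := zseq a 1) in *.
  assert (HDsym : Cmod (s - t) = Cmod (t - s)).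
  { rewrite <- Cmod_opp. f_equal. ring. }
  assert (Htm : (4.7 - p) * Cmod s <= 4.7 * Cmod t).
  { assert (Cmod s <= Cmod t + Cmod (s - t)); [|lra].
    replace s with (t + (s - t))%C at 1 by ring. apply Cmod_triangle. }
  assert (Htm0 : 0 < Cmod t) by nra.
  assert (Ht0 : t <> 0) by (apply Cmod_gt_0; exact Htm0).
  set (q := Cmod (s - t) / Cmod t).
  (* The constant is [4.7 - 0.117]; note that [0.117 / 4.583 < 0.0257]. *)
  assert (Hq : 0 <= 4.583 * q <= p).
  { assert (q * Cmod t = Cmod (s - t)) by (unfold q; field; lra).
    assert (0 <= q) by (unfold q; apply Rle_mult_inv_pos; [apply Cmod_ge_0|exact Htm0]).
    split; [lra|]. apply (Rmult_le_reg_r (Cmod t)); [exact Htm0|].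
    assert (p * (4.583 * Cmod s) <= p * (4.7 * Cmod t)).
    { apply Rmult_le_compat_l; [lra|]. eapply Rle_trans; [|exact Htm]. apply Rmult_le_compat_r; lra. }
    lra. }
  assert (Hfirst : Cmod (a / t - a / s) < 0.0290).
  { rewrite Cmod_quotient_minus by assumption. fold q.
    set (A := Cmod a / Cmod s).
    assert (HA : A ^ 4 <= 1 + Cmod s).
    { assert (EA : Cmod a ^ 4 = Cmod s ^ 4 * Cmod (1 + s)).
      { rewrite <- !Cmod_pow, <- Cmod_mult, Es, EW, Cmod_opp. reflexivity. }
      assert (A ^ 4 = Cmod (1 + s)).
      { unfold A. apply (Rmult_eq_reg_l (Cmod s ^ 4)); [|apply pow_nonzero; lra].
        rewrite <- EA. field. lra. }
      rewrite H. eapply Rle_trans; [apply Cmod_triangle|]. rewrite Cmod_1. lra. }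
    (* Fourth powers are compared because [A^4] is what is controlled; numerically
       [0.00031 / 4.583^4 < 0.029^4]. *)
    apply Rnot_le_lt. intros L.
    assert (0.029 ^ 4 <= (A * q) ^ 4) by (apply pow_incr; lra).
    assert ((4.583 * q) ^ 4 <= p ^ 4) by (apply pow_incr; exact Hq).
    rewrite Rpow_mult_distr in *.
    assert (A ^ 4 * q ^ 4 <= (1 + Cmod s) * q ^ 4).
    { apply Rmult_le_compat_r; [apply pow_le; lra|exact HA]. }
    assert ((1 + Cmod s) * (4.583 ^ 4 * q ^ 4) <= (1 + Cmod s) * p ^ 4)
      by (apply Rmult_le_compat_l; lra).
    lra. }
  assert (close : forall k, zseq a (S k) <> 0 /\
    Cmod (s - zseq a (S k)) <= 0.0257 * Cmod (zseq a (S k))).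
  { induction k as [|k [IH0 IH]].
    - split; [exact Ht0|]. fold t. replace (Cmod (s - t)) with (q * Cmod t) by (unfold q; field; lra).
      apply Rmult_le_compat_r; lra.
    - destruct (step (S k)) as (Hm & Em & Ht & Et & _). rewrite <- zseq_S in Ht, Et.
      pose proof (contraction th W _ s _ _ Hth HW Hs Es Hm Em Ht Et IH) as HC.
      assert (Hzk : 0 < Cmod (zseq a (S k))) by (apply Cmod_gt_0; exact IH0).
      split.
      + intros F. rewrite F in HC. rewrite Cmod_0 in HC.
        replace (s - 0)%C with s in HC by ring. nra.
      + set (u := Cmod (zseq a (S (S k)))) in *. apply (Rmult_le_reg_r (Cmod (zseq a (S k)))); [exact Hzk|].
        assert (0 <= u) by apply Cmod_ge_0. nra. }
  assert (ratio : forall k, (1 <= k)%nat ->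
    Cmod (a / zseq a (S k) - a / s) < 1 / 14.68 * Cmod (a / zseq a k - a / s)).
  { intros [|k] Hk; [lia|].
    destruct (close k) as [IH0 IH]. destruct (close (S k)) as [IH0' _].
    destruct (step (S k)) as (Hm & Em & Ht & Et & _). rewrite <- zseq_S in Ht, Et.
    pose proof (contraction th W _ s _ _ Hth HW Hs Es Hm Em Ht Et IH) as HC.
    rewrite !Cmod_quotient_minus by assumption.
    set (z := zseq a (S k)) in *. set (z' := zseq a (S (S k))) in *.
    assert (Hz1 : 0 < Cmod z) by (apply Cmod_gt_0; exact IH0).
    assert (Hz2 : 0 < Cmod z') by (apply Cmod_gt_0; exact IH0').
    assert (HA : 0 < Cmod a / Cmod s) by (apply Rdiv_lt_0_compat; [apply Cmod_gt_0; exact ha|exact Hsm]).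
    (* A nonzero error turns [0.06 < 1 / 14.68] into a strict decrease. *)
    assert (HDz : 0 < Cmod (s - z)).
    { apply Cmod_gt_0. intros F. apply (Hne (S k)). fold z.
      transitivity ((s - z) + z)%C; [ring|]. rewrite F. ring. }
    assert (HX : 0 < Cmod (s - z) / Cmod z) by (apply Rdiv_lt_0_compat; assumption).
    assert (HR : Cmod (s - z') / Cmod z' <= 0.06 * (Cmod (s - z) / Cmod z)).
    { apply (Rmult_le_reg_r (Cmod z' * Cmod z)); [apply Rmult_lt_0_compat; assumption|].
      replace (Cmod (s - z') / Cmod z' * (Cmod z' * Cmod z)) with (Cmod (s - z') * Cmod z) by (field; lra).
      replace (0.06 * (Cmod (s - z) / Cmod z) * (Cmod z' * Cmod z))
        with (0.06 * (Cmod (s - z) * Cmod z')); [exact HC|].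
      set (c := 0.06). field. lra. }
    rewrite <- (Rmult_assoc (1 / 14.68)), (Rmult_comm (1 / 14.68)), Rmult_assoc.
    apply Rmult_lt_compat_l; [exact HA|]. lra. }
  exists s. split; [|intros xstar; split; [|split; [|split]]].
  - rewrite <- EW, <- Es. ring.
  - unfold xstar. transitivity (a * (a ^ 4 + s ^ 4 * (1 + s)) / s ^ 5)%C; [field; exact Hs0|].
    rewrite Es, EW. field. exact Hs0.
  - exact Hfirst.
  - unfold xstar, xseq. fold t.
    replace (a / t / (a / s) - 1)%C with ((s - t) / t)%C by (field; auto).
    rewrite Cmod_div by exact Ht0. fold q. lra.
  - intros k Hk. split; [exact (ratio k Hk)|].
    induction Hk as [|k Hk IH].
    + pose proof (ratio 1%nat (le_n 1)) as H1. fold t in H1. unfold xseq, xstar. rewrite pow_1. lra.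
    + pose proof (ratio (S k) ltac:(lia)) as H1. unfold xseq, xstar in *.
      replace (0.0290 / 14.68 ^ S k) with (1 / 14.68 * (0.0290 / 14.68 ^ k)); [lra|].
      simpl. field. split; [apply pow_nonzero|]; lra.
Qed.
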